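(* Let $2\leq s<\infty$ be an integer and let $\{3,5\}$ denote the icosahedron. Then $2^{\{3,5\},\mathcal{G}(s)}$ is a regular $4$-polytope of type $\{4,3,5\}$ with automorphism group $D_s^{6}\rtimes[3,5]$ of order $120\cdot(2s)^6$. Moreover, the group $G(2^{\{3,5\},\mathcal{G}(s)})=\langle\rho_0,\rho_1,\rho_2,\rho_3\rangle$ is the quotient of the Coxeter group $[4,3,5]$ by the relations $$(\rho_0\beta^{-3}\rho_0\beta^3)^2=id\quad\text{and}\quad(\rho_0\beta^5\rho_0\beta^5)^s=id,$$ where $\beta=\rho_1\rho_2\rho_3$.
   Context: C-groups and polytopes: a C-group of rank $m$ is a group $G$ with generating involutions $\rho_0,\dots,\rho_{m-1}$ satisfying $\langle\rho_i\mid i\in I\rangle\cap\langle\rho_j\mid j\in J\rangle=\langle\rho_k\mid k\in I\cap J\rangle$ for all $I,J\subseteq\{0,\dots,m-1\}$; it is a string C-group if $(\rho_i\rho_j)^2=id$ whenever $|i-j|\geq 2$. Abstract regular polytopes $\mathcal{P}$ of rank $m$ are in one-to-one correspondence with string C-groups $G(\mathcal{P})$ of rank $m$: the $i$-faces are the right cosets of $\langle\rho_j\mid j\neq i\rangle$, and vertices are the $0$-faces. The Schläfli type is $\{p_1,\dots,p_{m-1}\}$, $p_i$ being the order of $\rho_{i-1}\rho_i$, and $[p_1,\dots,p_{m-1}]$ denotes the corresponding Coxeter group with linear diagram. Construction of $2^{\mathcal{P},\mathcal{G}(s)}$: let $\mathcal{P}$ be a centrally symmetric regular $n$-polytope with group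 $G(\mathcal{P})=\langle\tau_0,\dots,\tau_{n-1}\rangle$, i.e. $G(\mathcal{P})$ has a proper central involution $\alpha$ fixing no vertex. Let $F_0$ be the base vertex, stabilized by $\langle\tau_1,\dots,\tau_{n-1}\rangle$. Let $W$ be the Coxeter group generated by involutions $\sigma_F$, one for each vertex $F$ of $\mathcal{P}$, with defining relations $\sigma_F^2=id$, $(\sigma_F\sigma_{F\alpha})^s=id$, and $(\sigma_F\sigma_{F'})^2=id$ for $F'\notin\{F,F\alpha\}$; so $W\cong D_s^{q}$, where $q$ is half the number of vertices and $D_s$ is the dihedral group of order $2s$. The group $G(\mathcal{P})$ acts on $W$ by $\tau^{-1}\sigma_F\tau=\sigma_{F\tau}$. Then $2^{\mathcal{P},\mathcal{G}(s)}$ is the regular $(n+1)$-polytope with group $G(2^{\mathcal{P},\mathcal{G}(s)}):=W\rtimes G(\mathcal{P})=\langle\rho_0,\dots,\rho_n\rangle$, where $\rho_0:=\sigma_{F_0}$ and $\rho_i:=\tau_{i-1}$ for $1\leq i\leq n$. For the icosahedron, $G(\mathcal{P})=[3,5]$ has order $120$, there are $12$ vertices, and $\alpha=(\tau_0\tau_1\tau_2)^5$. *)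

(* Defs.v *)
From HB Require Import structures.
From mathcomp Require Import all_boot all_fingroup all_solvable.
From mathcomp Require Import generic_quotient boolp classical_sets functions cardinality.

Set Implicit Arguments.
Unset Strict Implicit.
Unset Printing Implicit Defensive.

Local Open Scope quotient_scope.
Local Open Scope classical_set_scope.
Local Open Scope group_scope.

(* MathComp's [{group gT}] lives inside finite groups; the notions below are
   needed for arbitrary groups ([groupType]), as [4,3,5] is infinite. *)

Definition subgroup (G : groupType) (S : set G) : Prop :=
  [/\ S 1, forall x y, S x -> S y -> S (x * y) & forall x, S x -> S x^-1].

Definition normal_subgroup (G : groupType) (S : set G) : Prop :=
  subgroup S /\ forall x y, S x -> S (x ^ y).

Definition gen_subgroup (G : groupType) (A : set G) : set G := smallest (@subgroup G) A.

Definition normal_closure (G : groupType) (A : set G) : set G :=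
  smallest (@normal_subgroup G) A.

Definition right_coset (G : groupType) (H : set G) (g : G) : set G :=
  [set h * g | h in H].

Definition has_order (G : groupType) (x : G) (n : nat) : Prop :=
  [/\ 0 < n, x ^+ n = 1 & forall k, 0 < k < n -> x ^+ k <> 1].

Definition group_iso (G H : groupType) (f : G -> H) : Prop :=
  {morph f : x y / x * y} /\ bijective f.

(* [f] exhibits [H] as the quotient of [G] by the relations [r = 1], [r] in
   [A]. *)
Definition quotient_by (G H : groupType) (A : set G) (f : G -> H) : Prop :=
  [/\ {morph f : x y / x * y}, (forall y, exists x, f x = y)
    & [set x | f x = 1] = normal_closure A].

Section StringCGroup.
Variables (G : groupType) (m : nat) (rho : 'I_m -> G).

Definition C_group : Prop :=
  [/\ gen_subgroup (range rho) = setT,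
      forall i, has_order (rho i) 2
    & forall I J : set 'I_m,
        gen_subgroup (rho @` I) `&` gen_subgroup (rho @` J) = gen_subgroup (rho @` (I `&` J))].

(* The regular polytopes of rank [m] are the string C-groups of rank [m]: the
   generated group is the automorphism group of the polytope, whose [i]-faces
   are the cosets [face i] below. *)
Definition string_C_group : Prop :=
  C_group /\
  forall i j : 'I_m, (i.+1 < j) || (j.+1 < i) -> (rho i * rho j) ^+ 2 = 1.

Definition face_stabilizer (i : 'I_m) : set G := gen_subgroup (rho @` [set~ i]).

Definition face (i : 'I_m) : choiceType := range (right_coset (face_stabilizer i)).

Lemma face_shift_subproof (i : 'I_m) (F : face i) (g : G) :
  [set x * g | x in val F] \in range (right_coset (face_stabilizer i)).
Proof.
have /set_mem[h _ <-] := valP F; apply/mem_set; exists (h * g) => //.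
rewrite predeqE => x; split=> [[y Hy <-]|[_ [y Hy <-] <-]].
  by exists (y * h); [exists y | rewrite mulgA].
by exists y; rewrite ?mulgA.
Qed.

Definition face_shift (i : 'I_m) (F : face i) (g : G) : face i :=
  exist _ [set x * g | x in val F] (face_shift_subproof F g).

Lemma face_shift1 i (F : face i) : face_shift F 1 = F.
Proof.
apply: val_inj => /=; rewrite predeqE => x; split=> [[y Fy <-]|Fx].
  by rewrite mulg1.
by exists x; rewrite ?mulg1.
Qed.

Lemma face_shiftM i (F : face i) g h :
  face_shift F (g * h) = face_shift (face_shift F g) h.
Proof.
apply: val_inj => /=; rewrite predeqE => x; split=> [[y Fy <-]|[_ [y Fy <-] <-]].
  by exists (y * g); [exists y | rewrite mulgA].
by exists y; rewrite ?mulgA.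
Qed.

Lemma base_face_subproof (i : 'I_m) :
  face_stabilizer i \in range (right_coset (face_stabilizer i)).
Proof.
apply/mem_set; exists 1 => //; rewrite predeqE => x.
by split=> [[y Hy <-]|Hx]; [rewrite mulg1 | exists x; rewrite ?mulg1].
Qed.

Definition base_face (i : 'I_m) : face i :=
  exist _ (face_stabilizer i) (base_face_subproof i).

End StringCGroup.

Definition schlafli_type (G : groupType) (p : seq nat)
    (rho : 'I_(size p).+1 -> G) : Prop :=
  forall i : 'I_(size p), has_order (rho (inord i) * rho (inord i.+1)) (nth 0%N p i).

Section Coxeter.
Variables (I : choiceType) (m : I -> I -> nat).

(* Generators of a Coxeter group are involutions, so its elements are classes
   of words without inverse letters, and reversing a word inverts it.  The
   values [m i i] are irrelevant, and [m i j = 0] means no relation. *)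
Inductive cox_rel : seq I -> seq I -> Prop :=
| CoxRefl u : cox_rel u u
| CoxSym u v : cox_rel u v -> cox_rel v u
| CoxTrans u v w : cox_rel u v -> cox_rel v w -> cox_rel u w
| CoxCat u u' v v' :
    cox_rel u u' -> cox_rel v v' -> cox_rel (u ++ v) (u' ++ v')
| CoxInvol i : cox_rel [:: i; i] [::]
| CoxOrder i j : cox_rel (flatten (nseq (m i j) [:: i; j])) [::].

Definition cox_relb u v : bool := `[< cox_rel u v >].

Lemma cox_relb_refl : reflexive cox_relb.
Proof. by move=> u; apply/asboolP/CoxRefl. Qed.

Lemma cox_relb_sym : symmetric cox_relb.
Proof. by move=> u v; apply/asboolP/asboolP; apply: CoxSym. Qed.

Lemma cox_relb_trans : transitive cox_relb.
Proof.
by move=> v u w /asboolP uv /asboolP vw; apply/asboolP; apply: CoxTrans uv vw.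
Qed.

Canonical cox_equiv := EquivRel cox_relb cox_relb_refl cox_relb_sym cox_relb_trans.

Definition coxeter : Type := {eq_quot cox_equiv}.
HB.instance Definition _ := Choice.copy coxeter {eq_quot cox_equiv}.

Definition cox_word (u : seq I) : coxeter := \pi_({eq_quot cox_equiv}) u.
Definition cox_repr (x : coxeter) : seq I := repr (x : {eq_quot cox_equiv}).

Lemma cox_reprK x : cox_word (cox_repr x) = x.
Proof. exact: reprK. Qed.

Lemma cox_wordE u v : cox_word u = cox_word v <-> cox_rel u v.
Proof. by split=> [/eqquotP/asboolP|uv]; [|apply/eqquotP/asboolP]. Qed.

Lemma cox_repr_word u : cox_rel (cox_repr (cox_word u)) u.
Proof. by apply/cox_wordE; rewrite cox_reprK. Qed.

Lemma cox_rev_cancel u : cox_rel (rev u ++ u) [::].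
Proof.
elim: u => [|i u IHu]; first exact: CoxRefl.
rewrite rev_cons cat_rcons.
apply: CoxTrans IHu; apply: CoxCat (CoxRefl _) _.
exact: (CoxCat (CoxInvol i) (CoxRefl u)).
Qed.

Lemma cox_rel_rev u v : cox_rel u v -> cox_rel (rev u) (rev v).
Proof.
move=> uv; apply: (@CoxTrans _ (rev u ++ (v ++ rev v))).
  rewrite -[X in cox_rel X _]cats0; apply: CoxCat (CoxRefl _) _.
  by apply: CoxSym; rewrite -{1}[v]revK; apply: cox_rev_cancel.
rewrite catA -[X in cox_rel _ X]cat0s; apply: CoxCat (CoxRefl _).
apply: CoxTrans (cox_rev_cancel u).
exact: CoxCat (CoxRefl _) (CoxSym uv).
Qed.

Definition cox_mul x y := cox_word (cox_repr x ++ cox_repr y).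
Definition cox_inv x := cox_word (rev (cox_repr x)).

Lemma cox_mul_word u v : cox_mul (cox_word u) (cox_word v) = cox_word (u ++ v).
Proof. by apply/cox_wordE; apply: CoxCat; apply: cox_repr_word. Qed.

Lemma cox_inv_word u : cox_inv (cox_word u) = cox_word (rev u).
Proof. by apply/cox_wordE; apply/cox_rel_rev/cox_repr_word. Qed.

Lemma cox_mulA : associative cox_mul.
Proof.
move=> x y z; rewrite -(cox_reprK x) -(cox_reprK y) -(cox_reprK z).
by rewrite !cox_mul_word catA.
Qed.

Lemma cox_mul1x : left_id (cox_word [::]) cox_mul.
Proof. by move=> x; rewrite -(cox_reprK x) cox_mul_word. Qed.

Lemma cox_mulx1 : right_id (cox_word [::]) cox_mul.
Proof. by move=> x; rewrite -(cox_reprK x) cox_mul_word cats0. Qed.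

Lemma cox_mulVx : left_inverse (cox_word [::]) cox_inv cox_mul.
Proof.
move=> x; rewrite -(cox_reprK x) cox_inv_word cox_mul_word.
by apply/cox_wordE/cox_rev_cancel.
Qed.

Lemma cox_mulxV : right_inverse (cox_word [::]) cox_inv cox_mul.
Proof.
move=> x; rewrite -(cox_reprK x) cox_inv_word cox_mul_word.
by apply/cox_wordE; rewrite -{1}[cox_repr x]revK; apply: cox_rev_cancel.
Qed.

HB.instance Definition _ :=
  isGroup.Build coxeter cox_mulA cox_mul1x cox_mulx1 cox_mulVx cox_mulxV.

Definition cox_gen (i : I) : coxeter := cox_word [:: i].

Lemma cox_wordM u v : cox_word (u ++ v) = cox_word u * cox_word v.
Proof. by rewrite -cox_mul_word. Qed.

Lemma cox_word1 : cox_word [::] = 1. Proof. by []. Qed.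

Lemma cox_wordV u : (cox_word u)^-1 = cox_word (rev u).
Proof. exact: cox_inv_word. Qed.

(* The endomorphism of the Coxeter group induced by a map of its diagram. *)
Section Map.
Variables (f : I -> I) (f_m : forall i j, m (f i) (f j) = m i j).

Definition cox_map (x : coxeter) : coxeter := cox_word (map f (cox_repr x)).

Lemma cox_rel_map u v : cox_rel u v -> cox_rel (map f u) (map f v).
Proof using f_m.
elim=> {u v} [u|u v _|u v w _ uv _ vw|u u' v v' _ uu _ vv|i|i j].
- exact: CoxRefl.
- exact: CoxSym.
- exact: CoxTrans uv vw.
- by rewrite !map_cat; apply: CoxCat.
- exact: CoxInvol.
rewrite map_flatten map_nseq /= -f_m; exact: CoxOrder.
Qed.

Lemma cox_map_word u : cox_map (cox_word u) = cox_word (map f u).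
Proof using f_m. by apply/cox_wordE/cox_rel_map/cox_repr_word. Qed.

Lemma cox_mapM : {morph cox_map : x y / x * y}.
Proof using f_m.
move=> x y; rewrite -(cox_reprK x) -(cox_reprK y) -cox_wordM !cox_map_word.
by rewrite map_cat cox_wordM.
Qed.

End Map.
End Coxeter.

Definition linear_diagram (p : seq nat) (i j : 'I_(size p).+1) : nat :=
  if j == i.+1 :> nat then nth 0%N p i
  else if i == j.+1 :> nat then nth 0%N p j
  else 2.

(* The string Coxeter group with linear diagram p = (p_1, ..., p_{m-1}). *)
Definition linear_coxeter (p : seq nat) : groupType :=
  coxeter (@linear_diagram p).

Definition linear_gen (p : seq nat) (i : 'I_(size p).+1) : linear_coxeter p :=
  cox_gen (@linear_diagram p) i.

(* Right actions of [G] on [W] by group automorphisms. *)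
Record waction (W G : groupType) := WAction {
  wact :> W -> G -> W;
  wact1 : forall w, wact w 1 = w;
  wactM : forall w g h, wact w (g * h) = wact (wact w g) h;
  wact_morph : forall g, {morph wact^~ g : v w / v * w}
}.

(* The pair [(g, w)] stands for the product [g * w], so that conjugation
   [w ^ g = g^-1 * w * g] is the action [A w g] (see [sd_conj]). *)
Definition semidirect (W G : groupType) (A : waction W G) : Type :=
  (G * W)%type.

Section SemidirectProduct.
Variables (W G : groupType) (A : waction W G).

HB.instance Definition _ := Choice.copy (semidirect A) (G * W)%type.

Definition sd_mul (x y : semidirect A) : semidirect A :=
  (x.1 * y.1, A x.2 y.1 * y.2).
Definition sd_one : semidirect A := (1, 1).
Definition sd_inv (x : semidirect A) : semidirect A := (x.1^-1, (A x.2 x.1^-1)^-1).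

Lemma wact_one g : A 1 g = 1.
Proof. by apply: (@mulgI _ (A 1 g)); rewrite mulg1 -wact_morph mulg1. Qed.

Lemma wactV w g : A w^-1 g = (A w g)^-1.
Proof. by apply: (@mulgI _ (A w g)); rewrite -wact_morph !mulgV wact_one. Qed.

Lemma sd_mulA : associative sd_mul.
Proof. by move=> x y z; rewrite /sd_mul /= wact_morph wactM !mulgA. Qed.

Lemma sd_mul1x : left_id sd_one sd_mul.
Proof. by case=> g w; rewrite /sd_mul /= wact_one !mul1g. Qed.

Lemma sd_mulx1 : right_id sd_one sd_mul.
Proof. by case=> g w; rewrite /sd_mul /= wact1 !mulg1. Qed.

Lemma sd_mulVx : left_inverse sd_one sd_inv sd_mul.
Proof.
by case=> g w; rewrite /sd_mul /= wactV -wactM mulVg wact1 mulVg.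
Qed.

Lemma sd_mulxV : right_inverse sd_one sd_inv sd_mul.
Proof. by case=> g w; rewrite /sd_mul /= !mulgV. Qed.

HB.instance Definition _ :=
  isGroup.Build (semidirect A) sd_mulA sd_mul1x sd_mulx1 sd_mulVx sd_mulxV.

Definition sd_left (g : G) : semidirect A := (g, 1).
Definition sd_right (w : W) : semidirect A := (1, w).

Lemma sd_conj g w : sd_right w ^ sd_left g = sd_right (A w g).
Proof.
rewrite conjgE; congr (_, _) => /=; first by rewrite mul1g mulVg.
by rewrite wact_one invg1 wact_one mul1g mulg1.
Qed.

End SemidirectProduct.

Section CentralSymmetry.
Variables (G : groupType) (n : nat) (tau : 'I_n.+1 -> G) (alpha : G).

Definition vertex : choiceType := face tau ord0.

Definition base_vertex : vertex := base_face tau ord0.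

Record central_symmetry : Prop := CentralSymmetry {
  cs_central : forall g, commute alpha g;
  cs_order : has_order alpha 2;
  cs_free : forall F : vertex, face_shift F alpha <> F
}.

Hypothesis alphaP : central_symmetry.
Variable s : nat.

Definition antipodal_diagram (F F' : vertex) : nat :=
  if F' == face_shift F alpha then s else 2.

Definition vertex_coxeter : groupType := coxeter antipodal_diagram.

Definition vertex_gen (F : vertex) : vertex_coxeter :=
  cox_gen antipodal_diagram F.

Lemma antipodal_diagram_shift g F F' :
  antipodal_diagram (face_shift F g) (face_shift F' g) = antipodal_diagram F F'.
Proof using alphaP.
rewrite /antipodal_diagram -face_shiftM -(cs_central alphaP g) face_shiftM.
suff -> : (face_shift F' g == face_shift (face_shift F alpha) g) =
          (F' == face_shift F alpha) by [].
apply/eqP/eqP => [|-> //] /(congr1 (fun E => face_shift E g^-1)).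
by rewrite -!face_shiftM !mulgV !mulg1 face_shift1.
Qed.

Definition vertex_map (w : vertex_coxeter) (g : G) : vertex_coxeter :=
  cox_map (fun F => face_shift F g) w.

Lemma vertex_map1 w : vertex_map w 1 = w.
Proof using alphaP.
rewrite -(cox_reprK w) /vertex_map cox_map_word; last first.
  exact: antipodal_diagram_shift.
by rewrite (eq_map (@face_shift1 _ _ tau ord0)) map_id.
Qed.

Lemma vertex_mapM w g h : vertex_map w (g * h) = vertex_map (vertex_map w g) h.
Proof using alphaP.
have mK g' u : vertex_map (cox_word _ u) g' = cox_word _ [seq face_shift F g' | F <- u].
  exact/cox_map_word/antipodal_diagram_shift.
rewrite -(cox_reprK w) !mK -map_comp.
by congr cox_word; apply: eq_map => F; apply: face_shiftM.
Qed.

Lemma vertex_map_morph g : {morph vertex_map^~ g : v w / v * w}.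
Proof using alphaP. exact/cox_mapM/antipodal_diagram_shift. Qed.

Definition vertex_action : waction vertex_coxeter G :=
  WAction vertex_map1 vertex_mapM vertex_map_morph.

Lemma vertex_action_gen F g :
  vertex_action (vertex_gen F) g = vertex_gen (face_shift F g).
Proof. exact/cox_map_word/antipodal_diagram_shift. Qed.

(* The group W ><| G(P) of 2^{P, G(s)}; [power_gen] lists rho_0 = sigma_{F_0}
   followed by the generators of G(P). *)
Definition power_group : groupType := semidirect vertex_action.

Definition power_gen (i : 'I_n.+2) : power_group :=
  if unlift ord0 i is Some j then sd_left vertex_action (tau j)
  else sd_right vertex_action (vertex_gen base_vertex).

End CentralSymmetry.

(* D_s^q, where D_s has order 2 * s, i.e. D_s is the library's ['D_(2 * s)]. *)
Definition dihedral_power (s q : nat) : groupType :=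
  {ffun 'I_q -> 'D_((2 * s)%N)}.

Section Icosahedron.

Definition ico_group : groupType := linear_coxeter [:: 3; 5]%N.

Definition ico_tau : 'I_3 -> ico_group := @linear_gen [:: 3; 5]%N.

Definition ico_alpha : ico_group :=
  (ico_tau (inord 0) * ico_tau (inord 1) * ico_tau (inord 2)) ^+ 5.

(* [ico_alpha] is central of order 2: explicit braid moves between reduced
   words of the longest element of the Coxeter group [3,5]. *)
Let ev (u : seq nat) : ico_group :=
  cox_word _ [seq (inord i : 'I_3) | i <- u].

Let evM u v : ev (u ++ v) = ev u * ev v.
Proof. by rewrite /ev map_cat cox_wordM. Qed.

Let evV u : (ev u)^-1 = ev (rev u).
Proof. by rewrite /ev cox_wordV map_rev. Qed.

Let braid_moves : seq (seq nat * seq nat) :=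
  [:: ([:: 0; 1; 0], [:: 1; 0; 1]); ([:: 0; 2], [:: 2; 0]);
      ([:: 1; 2; 1; 2; 1], [:: 2; 1; 2; 1; 2]);
      ([:: 1; 0; 1], [:: 0; 1; 0]); ([:: 2; 0], [:: 0; 2]);
      ([:: 2; 1; 2; 1; 2], [:: 1; 2; 1; 2; 1])]%N.

Let ev_order i j : i < 3 -> j < 3 ->
  ev (flatten (nseq (@linear_diagram [:: 3; 5]%N (inord i) (inord j))
                    [:: i; j])) = 1.
Proof.
move=> i3 j3; rewrite /ev map_flatten map_nseq /=.
exact/cox_wordE/CoxOrder.
Qed.

Let ev_braid k : ev (nth ([::], [::]) braid_moves k).1 =
                 ev (nth ([::], [::]) braid_moves k).2.
Proof.
have base u v : ev (u ++ rev v) = 1 -> ev u = ev v.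
  by rewrite evM -evV => uv; apply: (@mulIg _ (ev v)^-1); rewrite uv mulgV.
have oE i j : i < 3 -> j < 3 ->
    ev (flatten (nseq (if j == i.+1 then nth 0%N [:: 3; 5]%N i else
                       if i == j.+1 then nth 0%N [:: 3; 5]%N j else 2)
                      [:: i; j])) = 1.
  by move=> i3 j3; rewrite -(ev_order i3 j3) /linear_diagram !inordK.
have e01 := @oE 0%N 1%N isT isT; have e10 := @oE 1%N 0%N isT isT.
have e02 := @oE 0%N 2%N isT isT; have e20 := @oE 2%N 0%N isT isT.
have e12 := @oE 1%N 2%N isT isT; have e21 := @oE 2%N 1%N isT isT.
by case: k => [|[|[|[|[|[|k]]]]]]; rewrite /= ?nth_nil //; apply: base.
Qed.

Let move (u : seq nat) (kj : nat * nat) : seq nat :=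
  let lr := nth ([::], [::]) braid_moves kj.2 in
  if take (size lr.1) (drop kj.1 u) == lr.1
  then take kj.1 u ++ lr.2 ++ drop (size lr.1) (drop kj.1 u) else u.

Let ev_move u kj : ev (move u kj) = ev u.
Proof.
rewrite /move; case: eqP => // e.
rewrite -[in RHS](cat_take_drop kj.1 u).
rewrite -[in RHS](cat_take_drop (size (nth ([::], [::]) braid_moves kj.2).1)
  (drop kj.1 u)).
by rewrite e !evM ev_braid.
Qed.

Let ev_moves ms u : ev (foldl move u ms) = ev u.
Proof. by elim: ms u => //= kj ms IHms u; rewrite IHms ev_move. Qed.

Let w0 : seq nat := flatten (nseq 5 [:: 0; 1; 2]%N).

Let ev_w0 : ev w0 = ico_alpha.
Proof.
have -> : ico_alpha = ev [:: 0; 1; 2]%N ^+ 5.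
  by rewrite (evM [:: 0; 1]%N [:: 2]%N) (evM [:: 0]%N [:: 1]%N).
rewrite /w0; elim: 5 => [|k IHk]; first by rewrite expg0.
by rewrite expgS -IHk -evM.
Qed.

Let ev_sq i : i < 3 -> ev [:: i; i] = 1.
Proof. by move=> _; apply/cox_wordE/CoxInvol. Qed.

Let alpha_comm0 : commute ico_alpha (ev [:: 0]%N).
Proof.
rewrite /commute -ev_w0.
have -> : ev w0 = ev ([:: 0]%N ++ behead w0) by [].
rewrite evM -mulgA -evM; congr (_ * _); apply: esym.
rewrite -evM -(ev_moves [:: (1, 4); (7, 4); (5, 0); (13, 4); (11, 0); (7, 2);
  (6, 1); (2, 5); (0, 3); (2, 1); (6, 3); (8, 1)]%N (behead w0 ++ [:: 0]%N)).
by vm_compute.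
Qed.

Let alpha_comm1 : commute ico_alpha (ev [:: 1]%N).
Proof.
pose w1 := foldl move w0 [:: (2, 4); (0, 0)]%N.
rewrite /commute -ev_w0.
have -> : ev w0 = ev ([:: 1]%N ++ behead w1).
  by rewrite -(ev_moves [:: (2, 4); (0, 0)]%N w0).
rewrite evM -mulgA -evM; congr (_ * _); apply: esym.
rewrite -evM -(ev_moves [:: (4, 4); (10, 4); (8, 0); (10, 2); (9, 1); (5, 5);
  (3, 3); (5, 1); (9, 3); (11, 1)]%N (behead w1 ++ [:: 1]%N)).
rewrite -(ev_moves [:: (2, 4); (0, 0)]%N w0).
by vm_compute.
Qed.

Let alpha_comm2 : commute ico_alpha (ev [:: 2]%N).
Proof.
have cb : commute ico_alpha (ev [:: 0; 1; 2]%N).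
  rewrite -ev_w0 /w0 /commute -!evM; congr ev.
have -> : ev [:: 2]%N = ev [:: 1]%N * ev [:: 0]%N * ev [:: 0; 1; 2]%N.
  rewrite -mulgA -!evM /= (evM [:: 1]%N [:: 0, 0, 1 & [:: 2]]%N).
  rewrite (evM [:: 0; 0]%N [:: 1; 2]%N) ev_sq // mul1g -evM.
  by rewrite (evM [:: 1; 1]%N [:: 2]%N) ev_sq // mul1g.
by apply: commuteM => //; apply: commuteM.
Qed.

Let alpha_sq : ico_alpha ^+ 2 = 1.
Proof.
have w0V : ev w0 = ev (rev w0).
  rewrite -(ev_moves [:: (2, 4); (0, 0); (8, 4); (6, 0); (2, 2); (1, 1);
    (6, 4); (7, 5); (5, 3); (7, 1); (11, 3); (13, 1); (4, 4); (2, 0); (10, 4);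
    (8, 0); (4, 2); (3, 1); (8, 4); (9, 5); (7, 3); (9, 1); (6, 4); (4, 0);
    (0, 2); (4, 4); (5, 5); (3, 3); (9, 3); (2, 4); (8, 4)]%N w0).
  by vm_compute.
by rewrite expgS expg1 -ev_w0 {2}w0V -evV mulgV.
Qed.

Let alpha_central g : commute ico_alpha g.
Proof.
rewrite -(cox_reprK g); elim: (cox_repr g) => [|i u IHu]; first exact: commute1.
rewrite -(cat1s i u) cox_wordM; apply: commuteM => //.
have -> : cox_word (@linear_diagram [:: 3; 5]%N) [:: i] = ev [:: val i].
  by rewrite /ev /= inord_val.
case: i => [[|[|[|//]]] ?] /=.
- exact: alpha_comm0.
- exact: alpha_comm1.
- exact: alpha_comm2.
Qed.

(* The permutations of the 12 vertices, the base vertex being number 0, show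
   that [ico_alpha] lies in no vertex stabilizer. *)
Let vtable : seq (seq nat) :=
  [:: [:: 1; 0; 2; 3; 5; 4; 7; 6; 8; 9; 11; 10];
      [:: 0; 2; 1; 4; 3; 5; 6; 8; 7; 10; 9; 11];
      [:: 0; 1; 3; 2; 6; 7; 4; 5; 9; 8; 10; 11]]%N.

Let vact (x : nat) (u : seq 'I_3) : nat :=
  foldl (fun x i => nth 0%N (nth [::] vtable (val i)) x) x u.

Let vact_lt x u : x < 12 -> vact x u < 12.
Proof.
elim: u x => //= i u IHu x x12; apply: IHu.
by case: i => [[|[|[|//]]] ?] /=;
  do 12!(case: x x12 => [//|x x12]).
Qed.

Let vact_rel u v : cox_rel (@linear_diagram [:: 3; 5]%N) u v ->
  forall x, x < 12 -> vact x u = vact x v.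
Proof.
elim=> {u v} [//|u v _ IH|u v w _ uv _ vw|u u' v v' _ uu _ vv|i|i j] x x12.
- by rewrite IH.
- by rewrite uv ?vw.
- by rewrite /vact !foldl_cat -!/(vact _ _) uu // vv // vact_lt.
- by case: i => [[|[|[|//]]] ?]; do 12!(case: x x12 => [//|x x12]).
- by case: i => [[|[|[|//]]] ?]; case: j => [[|[|[|//]]] ?];
    do 12!(case: x x12 => [//|x x12]).
Qed.

Let pos (g : ico_group) : nat := vact 0 (cox_repr g).

Let pos_word u : pos (cox_word _ u) = vact 0 u.
Proof. exact/vact_rel/isT/cox_repr_word. Qed.

Let pos_stab : face_stabilizer ico_tau ord0 `<=` [set g | pos g = 0%N].
Proof.
apply: smallest_sub => [|_ [i /= i0 <-]].
- have posM x y : pos x = 0%N -> pos (x * y) = pos y.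
    rewrite -(cox_reprK x) -(cox_reprK y) -cox_wordM !pos_word => x0.
    by rewrite /vact foldl_cat -!/(vact _ _) x0.
  split=> [|x y /= x0|x /= x0]; first exact: (pos_word [::]).
    by rewrite posM.
  by rewrite -(posM _ _ x0) mulgV; apply: (pos_word [::]).
- rewrite /= (pos_word [:: i]); case: i i0 => [[|[|[|//]]] ?] //= [].
  exact: val_inj.
Qed.

Let pos_alpha : pos ico_alpha = 11.
Proof. by rewrite -ev_w0 pos_word /vact /= !inordK. Qed.

Lemma ico_central_symmetry : central_symmetry ico_tau ico_alpha.
Proof.
split; first exact: alpha_central.
- split=> //; case=> [|[|k]] // _; rewrite expg1 => a1.
  by have := pos_alpha; rewrite a1 pos_word.
case=> A AP /(congr1 val) /=; have /set_mem[g _ gA] := AP.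
rewrite -gA => e.
have : right_coset (face_stabilizer ico_tau ord0) g (g * ico_alpha).
  rewrite -e; exists g => //; exists 1; rewrite ?mul1g //.
  by rewrite /face_stabilizer /gen_subgroup => B [[]].
case=> h Hh; rewrite -(alpha_central g) => /mulIg ha.
by have := pos_stab Hh; rewrite /= ha pos_alpha.
Qed.

End Icosahedron.

(* Main.v *)
Require Import Defs.
From HB Require Import structures.
From mathcomp Require Import all_boot all_fingroup all_solvable.
From mathcomp Require Import generic_quotient.
From mathcomp Require Import boolp classical_sets functions cardinality.

Set Implicit Arguments.
Unset Strict Implicit.
Unset Printing Implicit Defensive.

Local Open Scope classical_set_scope.
Local Open Scope group_scope.

(** The group of the polytope is a semidirect product of [3,5] and the Coxeter
  group W on the twelve vertices, and every claim reduces to knowing these two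
  factors exactly and to following words in their generators.

  The group [3,5] has a complete rewriting system of nine rules, each of which
  follows from the braid relations (ico_rules_sound). It leaves 120 irreducible
  words, which are told apart by their action on a triangular face
  (ico_words_key); this gives the order 120 and, since no rule introduces a new
  letter, a notion of support: an element lies in the subgroup generated by a
  set of generators exactly when its irreducible word uses no other letter.
  The stabilizer of the base vertex is found in the same way, so that vertices
  are numbers below twelve and antipodes have sum eleven.

  In W two generators commute unless their vertices are antipodal, so a word
  splits into six words, one for each antipodal pair (cox_word_classes). A word
  in two such generators has one of 2s dihedral normal forms, and these are
  distinct in the dihedral group of order 2s (dih_word_inj). Hence the
  coordinates of W in the six dihedral groups form an isomorphism
  (vertex_isoP), and an element is generated by its support, the vertices
  present in all of its expressions (vertex_gen_supp).

  The intersection property is then a formal consequence (supp_C_group): the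
  support of a pair (g, w) collects the letters of g, the generator rho_0 if w
  is nontrivial, and the letters needed to reach the vertices in the support
  of w from the base vertex. No letter enters the support of a product with
  rho_i except i itself.

  For the presentation, let Q be the quotient of [4,3,5] by the two relators.
  The last three generators of Q define a morphism from [3,5], under which the
  stabilizer of the base vertex centralizes the first generator; the conjugates
  of the latter are therefore indexed by the vertices. The stabilizer has four
  orbits on the vertices (vertex_orbits): the base vertex, its antipode, its
  neighbours and the neighbours of its antipode. For the last three, the
  relations required by W are the second relator, the relation of order 4
  between the first two generators, and the first relator. So W and [3,5] map
  compatibly to Q, and the resulting morphism from the semidirect product
  inverts the projection of Q onto it (power_map_section): an element of
  [4,3,5] which is trivial in the polytope group is trivial in Q. *)
(** * Morphisms, generation and C-groups *)

Section Morphisms.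
Variables (G H : groupType) (f : G -> H).
Hypothesis fM : {morph f : x y / x * y}.

Lemma morphism1 : f 1 = 1.
Proof. by apply: (@mulgI _ (f 1)); rewrite -fM !mulg1. Qed.

Lemma morphismV x : f x^-1 = (f x)^-1.
Proof. by apply: (@mulgI _ (f x)); rewrite -fM !mulgV morphism1. Qed.

Lemma morphismX n x : f (x ^+ n) = f x ^+ n.
Proof. by elim: n => [|n IHn]; rewrite ?expg0 ?morphism1 // !expgS fM IHn. Qed.

Lemma morphismJ x y : f (x ^ y) = f x ^ f y.
Proof. by rewrite !conjgE !fM morphismV. Qed.

Lemma morphism_prod (I : Type) (r : seq I) (F : I -> G) :
  f (\prod_(i <- r) F i) = \prod_(i <- r) f (F i).
Proof. exact: (big_morph f fM morphism1). Qed.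

Lemma morphism_inj : (forall x, f x = 1 -> x = 1) -> injective f.
Proof.
move=> ker x y fxy; apply/divg1_eq/ker.
by rewrite fM morphismV fxy mulgV.
Qed.

Lemma ker_normal_subgroup : normal_subgroup [set x | f x = 1].
Proof.
split; first split=> [|x y /= fx fy|x /= fx].
- exact: morphism1.
- by rewrite fM fx fy mulg1.
- by rewrite morphismV fx invg1.
- by move=> x y /= fx; rewrite morphismJ fx conj1g.
Qed.

End Morphisms.

Section Generation.
Variable G : groupType.
Implicit Types (A B S : set G) (x y : G).

Lemma gen_subgroupP A : subgroup (gen_subgroup A).
Proof.
split=> [S [[]]//|x y Ax Ay S SP|x Ax S SP].
  by have [[_ SM _] _] := SP; apply: SM; [apply: Ax | apply: Ay].
by have [[_ _ SV] _] := SP; apply: SV; apply: Ax.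
Qed.

Lemma gen_subgroup1 A : gen_subgroup A 1. Proof. by have [] := gen_subgroupP A. Qed.

Lemma gen_subgroupM A x y :
  gen_subgroup A x -> gen_subgroup A y -> gen_subgroup A (x * y).
Proof. by have [_ + _] := gen_subgroupP A; apply. Qed.

Lemma gen_subgroupV A x : gen_subgroup A x -> gen_subgroup A x^-1.
Proof. by have [_ _] := gen_subgroupP A; apply. Qed.

Lemma gen_subgroupJ A x y : gen_subgroup A x -> gen_subgroup A y -> gen_subgroup A (x ^ y).
Proof. by move=> Ax Ay; rewrite conjgE; do !apply: gen_subgroupM => //; apply: gen_subgroupV. Qed.

Lemma mem_genP A x : A x -> gen_subgroup A x.
Proof. exact: sub_gen_smallest. Qed.

Lemma gen_subgroup_min A S : subgroup S -> A `<=` S -> gen_subgroup A `<=` S.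
Proof. exact: smallest_sub. Qed.

Lemma gen_subgroupS A B : A `<=` B -> gen_subgroup A `<=` gen_subgroup B.
Proof.
by move=> AB; apply: gen_subgroup_min (gen_subgroupP B) _ => x /AB; apply: mem_genP.
Qed.

(** The elements generated by a set of involutions are products of these
  involutions, and may be built up from the right. *)
Lemma gen_involutions_ind A (P : G -> Prop) :
    (forall a, A a -> a * a = 1) -> P 1 ->
    (forall x a, P x -> A a -> P (x * a)) ->
  forall x, gen_subgroup A x -> P x.
Proof.
move=> A2 P1 PM x Ax; rewrite -(mul1g x).
pose S := [set z | forall y, (P y -> P (y * z)) /\ (P y -> P (y * z^-1))].
have subS : subgroup S.
  split=> [y|y z Py Pz w|y Py w]; first by rewrite invg1 mulg1.
    split=> Pw; first by rewrite mulgA; apply/(Pz _).1/(Py _).1.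
    by rewrite invgM mulgA; apply/(Py _).2/(Pz _).2.
  by rewrite invgK; split; apply (Py w).
suff /gen_subgroup_min/(_ _ Ax 1)[//|+ _] : A `<=` S by apply.
move=> a Aa y; split=> Py; first exact: PM.
by rewrite (mulg1_eq (A2 a Aa)); apply: PM.
Qed.

End Generation.
(* Membership in a generated subgroup unfolds to a product, whose arguments
   would otherwise be implicit in the following lemmas. *)
Arguments gen_subgroup1 {G} A.
Arguments gen_subgroupM {G A x y} _ _.
Arguments gen_subgroupV {G A x} _.
Arguments gen_subgroupJ {G A x y} _ _.
Arguments mem_genP {G A x} _.
Arguments gen_subgroup_min {G A S} _ _ _ _.
Arguments gen_subgroupS {G A B} _ _ _ .

Lemma gen_morphism (G H : groupType) (f : G -> H) (A : set G) (B : set H) :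
    {morph f : x y / x * y} -> (forall a, A a -> gen_subgroup B (f a)) ->
  forall x, gen_subgroup A x -> gen_subgroup B (f x).
Proof.
move=> fM AB; apply: gen_subgroup_min => //.
split=> [|x y /= Bx By|x /= Bx] /=.
- by rewrite (morphism1 fM); apply: gen_subgroup1.
- by rewrite fM; apply: gen_subgroupM.
- by rewrite (morphismV fM); apply: gen_subgroupV.
Qed.

Lemma has_order2 (G : groupType) (x : G) : x != 1 -> x * x = 1 -> has_order x 2.
Proof.
by move=> /eqP x1 xx; split=> //; case=> [|[|k]].
Qed.

(** If every element of [G] has a support, namely a set of generators which
  suffice to write it, and multiplication by one more generator enlarges the
  support at most by that generator, then [<rho_i | i in I>] consists of the
  elements whose support lies in [I]; such subgroups intersect as their index
  sets do. *)
Section Support.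
Variables (G : groupType) (m : nat) (rho : 'I_m -> G) (supp : G -> set 'I_m).
Hypothesis rho2 : forall i, rho i * rho i = 1.
Hypothesis supp1 : supp 1 = set0.
Hypothesis suppM : forall g i, supp (g * rho i) `<=` supp g `|` [set i].
Hypothesis gen_supp : forall g, gen_subgroup (rho @` supp g) g.

Lemma gen_suppE (I : set 'I_m) :
  gen_subgroup (rho @` I) = [set g | supp g `<=` I].
Proof.
apply/seteqP; split=> g /=.
  move: g; apply: gen_involutions_ind => [_ [i _ <-]||g _ sg [i Ii <-]] //.
    by rewrite supp1; apply: sub0set.
  by move=> j /suppM[/sg//|/= ->].
by move=> sg; apply: (gen_subgroupS (image_subset _ sg)); apply: gen_supp.
Qed.

Lemma supp_C_group : (forall i, rho i != 1) -> C_group rho.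
Proof.
move=> rho1; split.
- apply/seteqP; split=> // g _; move: (@gen_supp g).
  by apply: gen_subgroupS => _ [i _ <-]; exists i.
- by move=> i; apply: has_order2.
by move=> I J; rewrite !gen_suppE; apply/seteqP; split=> g /=; rewrite subsetI.
Qed.

End Support.

(** * Faces *)

Section Faces.
Variables (G : groupType) (m : nat) (rho : 'I_m -> G) (i : 'I_m).

Lemma face_baseP (F : face rho i) : exists g, F = face_shift (base_face rho i) g.
Proof.
have /set_mem[g _ gF] := valP F; exists g; apply: val_inj => /=.
by rewrite -gF.
Qed.

Lemma face_shift_base g h :
  face_shift (base_face rho i) g = face_shift (base_face rho i) h <->
  face_stabilizer rho i (g * h^-1).
Proof.
split=> [/(congr1 val) /= gh|gh].
  have : [set x * g | x in face_stabilizer rho i] g.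
    by exists 1; [apply: gen_subgroup1 | rewrite mul1g].
  by rewrite gh => -[x Sx <-]; rewrite mulgK.
apply: val_inj; apply/seteqP; split=> /= _ [x Sx <-].
  by exists (x * (g * h^-1)); [apply: gen_subgroupM | rewrite -!mulgA mulVg mulg1].
exists (x * (g * h^-1)^-1); first exact: gen_subgroupM Sx (gen_subgroupV gh).
by rewrite invgM invgK mulgA mulgVK.
Qed.

End Faces.

Lemma face_shift_stab (G : groupType) m (rho : 'I_m -> G) (i : 'I_m) t :
  face_stabilizer rho i t -> face_shift (base_face rho i) t = base_face rho i.
Proof.
move=> it; rewrite -[RHS]face_shift1; apply/face_shift_base.
by rewrite invg1 mulg1.
Qed.

(** * Universal properties *)

Section CoxeterLift.
Variables (I : choiceType) (m : I -> I -> nat) (H : groupType) (phi : I -> H).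

Definition cox_lift (x : coxeter m) : H := \prod_(i <- cox_repr x) phi i.

Hypothesis phi2 : forall i, phi i * phi i = 1.
Hypothesis phi_m : forall i j, (phi i * phi j) ^+ m i j = 1.

(** The defining relations of the Coxeter group are those that the values of
  [phi] are assumed to satisfy, so the value of a word depends only on its
  class. *)
Lemma cox_lift_rel u v :
  cox_rel m u v -> \prod_(i <- u) phi i = \prod_(i <- v) phi i.
Proof using phi2 phi_m.
elim=> {u v} [u|u v _ ->|u v w _ -> _ ->|u u' v v' _ uu _ vv|i|i j] //.
- by rewrite !big_cat /= uu vv.
- by rewrite !big_cons !big_nil mulg1 phi2.
rewrite big_nil -[RHS](phi_m i j); elim: (m i j) => [|k IHk].
  by rewrite big_nil expg0.
by rewrite /= !big_cons IHk expgS mulgA.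
Qed.

Lemma cox_lift_word u : cox_lift (cox_word m u) = \prod_(i <- u) phi i.
Proof using phi2 phi_m. exact/cox_lift_rel/cox_repr_word. Qed.

Lemma cox_lift_gen i : cox_lift (cox_gen m i) = phi i.
Proof using phi2 phi_m. by rewrite cox_lift_word big_seq1. Qed.

Lemma cox_liftM : {morph cox_lift : x y / x * y}.
Proof using phi2 phi_m.
move=> x y; rewrite -(cox_reprK x) -(cox_reprK y) -cox_wordM !cox_lift_word.
exact: big_cat.
Qed.

End CoxeterLift.

Section CoxeterInduction.
Variables (I : choiceType) (m : I -> I -> nat).

Lemma cox_gen2 i : cox_gen m i * cox_gen m i = 1.
Proof. by rewrite -cox_wordM; apply/cox_wordE/CoxInvol. Qed.

Lemma cox_gen_order i j : (cox_gen m i * cox_gen m j) ^+ m i j = 1.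
Proof.
rewrite -cox_wordM.
have <- : cox_word m (flatten (nseq (m i j) [:: i; j])) = 1.
  exact/cox_wordE/CoxOrder.
by elim: (m i j) => [|k IHk]; rewrite ?expg0 // expgS IHk -cox_wordM.
Qed.

Lemma cox_word_cons i u : cox_word m (i :: u) = cox_gen m i * cox_word m u.
Proof. by rewrite -cox_wordM. Qed.

Lemma cox_ind (P : coxeter m -> Prop) :
  P 1 -> (forall i x, P x -> P (cox_gen m i * x)) -> forall x, P x.
Proof.
move=> P1 PM x; rewrite -(cox_reprK x).
by elim: (cox_repr x) => // i u IHu; rewrite cox_word_cons; apply: PM.
Qed.

Lemma cox_morphism_eq (H : groupType) (f g : coxeter m -> H) :
    {morph f : x y / x * y} -> {morph g : x y / x * y} ->
    (forall i, f (cox_gen m i) = g (cox_gen m i)) -> f =1 g.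
Proof.
move=> fM gM fg; apply: cox_ind => [|i x IHx].
  by rewrite (morphism1 fM) (morphism1 gM).
by rewrite fM gM fg IHx.
Qed.

End CoxeterInduction.

Section SemidirectFactors.
Variables (W G : groupType) (A : waction W G).

Lemma sd_leftM : {morph sd_left A : g h / g * h}.
Proof. by move=> g h; congr (_, _); rewrite /= wact_one mulg1. Qed.

Lemma sd_rightM : {morph sd_right A : v w / v * w}.
Proof. by move=> v w; congr (_, _); rewrite /= ?wact1 ?mulg1. Qed.

Lemma sd_split (x : semidirect A) : x = sd_left A x.1 * sd_right A x.2.
Proof. by case: x => g w; congr (_, _); rewrite /= ?mulg1 // wact_one mul1g. Qed.

Lemma sd_mul_left x g : (x * sd_left A g : semidirect A) = (x.1 * g, A x.2 g).
Proof. by congr (_, _); rewrite /= mulg1. Qed.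

Lemma sd_mul_right x w : (x * sd_right A w : semidirect A) = (x.1, x.2 * w).
Proof. by congr (_, _); rewrite /= ?mulg1 ?wact1. Qed.

End SemidirectFactors.

Section SemidirectLift.
Variables (W G H : groupType) (A : waction W G) (f : G -> H) (k : W -> H).
Hypothesis fM : {morph f : x y / x * y}.
Hypothesis kM : {morph k : x y / x * y}.
Hypothesis kA : forall w g, k (A w g) = k w ^ f g.

Definition sd_lift (x : semidirect A) : H := f x.1 * k x.2.

(** In the product [g * w] the two factors may be exchanged at the cost of the
  action, which [kA] turns into conjugation in [H]. *)
Lemma sd_liftM : {morph sd_lift : x y / x * y}.
Proof using fM kM kA.
by case=> g w [h v]; rewrite /sd_lift /= fM kM kA conjgE !mulgA mulgK.
Qed.

End SemidirectLift.

(** The quotient by a normal subgroup of a possibly infinite group. It is built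
  as a type of classes with chosen representatives, like the Coxeter groups
  that it is applied to. *)
Section FactorGroup.
Local Open Scope quotient_scope.
Variables (G : groupType) (N : set G).
Hypothesis nN : normal_subgroup N.

Definition coset_rel (x y : G) : bool := `[< N (x^-1 * y) >].

Lemma coset_rel_refl : reflexive coset_rel.
Proof using nN. by move=> x; apply/asboolP; rewrite mulVg; have [[]] := nN. Qed.

Lemma coset_rel_sym : symmetric coset_rel.
Proof using nN.
have [[_ _ NV] _] := nN.
by move=> x y; apply/asboolP/asboolP=> /NV; rewrite invgM invgK.
Qed.

Lemma coset_rel_trans : transitive coset_rel.
Proof using nN.
have [[_ NM _] _] := nN.
move=> y x z /asboolP xy /asboolP yz; apply/asboolP.
by have := NM _ _ xy yz; rewrite -mulgA mulVKg.
Qed.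

Canonical coset_equiv := EquivRel coset_rel coset_rel_refl coset_rel_sym coset_rel_trans.

Definition factor_group : Type := {eq_quot coset_equiv}.
HB.instance Definition _ := Choice.copy factor_group {eq_quot coset_equiv}.

Definition quo (x : G) : factor_group := \pi_({eq_quot coset_equiv}) x.
Definition quo_repr (x : factor_group) : G := repr (x : {eq_quot coset_equiv}).

Lemma quo_reprK x : quo (quo_repr x) = x. Proof. exact: reprK. Qed.

Lemma quoE x y : quo x = quo y <-> N (x^-1 * y).
Proof. by split=> [/eqquotP/asboolP|xy]; [|apply/eqquotP/asboolP]. Qed.

Lemma quo_mul_subproof x x' y y' :
  quo x = quo x' -> quo y = quo y' -> quo (x * y) = quo (x' * y').
Proof using nN.
have [[_ NM _] NJ] := nN; move=> /quoE xx /quoE yy; apply/quoE.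
have -> : (x * y)^-1 * (x' * y') = (x^-1 * x') ^ y * (y^-1 * y').
  by rewrite conjgE invgM !mulgA mulgK.
by apply: NM => //; apply: NJ.
Qed.

Lemma quo_inv_subproof x x' : quo x = quo x' -> quo x^-1 = quo x'^-1.
Proof using nN.
have [[_ _ NV] NJ] := nN; move=> /quoE /NV/(NJ _ x^-1) xx; apply/quoE.
by move: xx; rewrite conjgE invgM mulgVK.
Qed.

Definition quo_mul x y := quo (quo_repr x * quo_repr y).
Definition quo_inv x := quo (quo_repr x)^-1.

Lemma quo_mulE x y : quo_mul (quo x) (quo y) = quo (x * y).
Proof using nN. by apply: quo_mul_subproof; rewrite quo_reprK. Qed.

Lemma quo_invE x : quo_inv (quo x) = quo x^-1.
Proof using nN. by apply: quo_inv_subproof; rewrite quo_reprK. Qed.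

Lemma quo_mulA : associative quo_mul.
Proof.
move=> x y z; rewrite -(quo_reprK x) -(quo_reprK y) -(quo_reprK z).
by rewrite !quo_mulE mulgA.
Qed.

Lemma quo_mul1x : left_id (quo 1) quo_mul.
Proof. by move=> x; rewrite -(quo_reprK x) quo_mulE mul1g. Qed.

Lemma quo_mulx1 : right_id (quo 1) quo_mul.
Proof. by move=> x; rewrite -(quo_reprK x) quo_mulE mulg1. Qed.

Lemma quo_mulVx : left_inverse (quo 1) quo_inv quo_mul.
Proof. by move=> x; rewrite -(quo_reprK x) quo_invE quo_mulE mulVg. Qed.

Lemma quo_mulxV : right_inverse (quo 1) quo_inv quo_mul.
Proof. by move=> x; rewrite -(quo_reprK x) quo_invE quo_mulE mulgV. Qed.

HB.instance Definition _ := isGroup.Build factor_group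
  quo_mulA quo_mul1x quo_mulx1 quo_mulVx quo_mulxV.

Lemma quoM : {morph quo : x y / x * y}.
Proof. by move=> x y; rewrite -quo_mulE. Qed.

Lemma quo_eq1 x : quo x = 1 <-> N x.
Proof.
have := quoE 1 x; rewrite (morphism1 quoM) invg1 mul1g => <-.
by split=> ->.
Qed.

End FactorGroup.

(** * A rewriting system for [3,5] *)

(** Words have letters in [nat] so that they can be computed with; [inord] reads
  letters above 2 as 0. *)
Definition ico_ev (u : seq nat) : ico_group :=
  \prod_(i <- u) ico_tau (inord i).

Lemma ico_evM u v : ico_ev (u ++ v) = ico_ev u * ico_ev v.
Proof. exact: big_cat. Qed.

Lemma ico_ev_cons i u : ico_ev (i :: u) = ico_tau (inord i) * ico_ev u.
Proof. exact: big_cons. Qed.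

Lemma ico_ev_word u :
  ico_ev u = cox_word (@linear_diagram [:: 3; 5]%N) [seq (inord i : 'I_3) | i <- u].
Proof.
elim: u => [|i u IHu] /=; first by rewrite /ico_ev big_nil.
by rewrite cox_word_cons ico_ev_cons IHu.
Qed.

Lemma ico_ev_repr (g : ico_group) : ico_ev (map val (cox_repr g)) = g.
Proof.
rewrite ico_ev_word -map_comp (eq_map (g := id)) ?map_id ?cox_reprK // => i.
by rewrite /= inord_val.
Qed.

Section BraidMoves.

(** The relations [(tau_i tau_j)^m = 1] of [3,5], in the equivalent form of an
  exchange of two alternating words, in both directions. *)
Definition braid_moves : seq (seq nat * seq nat) :=
  [:: ([:: 0; 1; 0], [:: 1; 0; 1]); ([:: 0; 2], [:: 2; 0]);
      ([:: 1; 2; 1; 2; 1], [:: 2; 1; 2; 1; 2]);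
      ([:: 1; 0; 1], [:: 0; 1; 0]); ([:: 2; 0], [:: 0; 2]);
      ([:: 2; 1; 2; 1; 2], [:: 1; 2; 1; 2; 1])]%N.

Lemma ico_tau2 i : ico_tau i * ico_tau i = 1.
Proof. exact: cox_gen2. Qed.

Lemma ico_tau_order i j : i < 3 -> j < 3 ->
  (ico_tau (inord i) * ico_tau (inord j)) ^+
     (if j == i.+1 then nth 0%N [:: 3; 5]%N i else
      if i == j.+1 then nth 0%N [:: 3; 5]%N j else 2) = 1.
Proof.
move=> i3 j3; rewrite -[RHS](cox_gen_order (@linear_diagram [:: 3; 5]%N)
  (inord i) (inord j)).
by rewrite /linear_diagram !inordK.
Qed.

Lemma ico_ev_braid k : ico_ev (nth ([::], [::]) braid_moves k).1 =
                       ico_ev (nth ([::], [::]) braid_moves k).2.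
Proof.
have evV u : (ico_ev u)^-1 = ico_ev (rev u).
  by rewrite !ico_ev_word cox_wordV map_rev.
have base u v : ico_ev (u ++ rev v) = 1 -> ico_ev u = ico_ev v.
  by rewrite ico_evM -evV => /divg1_eq.
have o i j n : i < 3 -> j < 3 -> n = (if j == i.+1 then nth 0%N [:: 3; 5]%N i else
      if i == j.+1 then nth 0%N [:: 3; 5]%N j else 2) ->
    ico_ev (flatten (nseq n [:: i; j])) = 1.
  move=> i3 j3 nE; rewrite -[RHS](ico_tau_order i3 j3) -nE {nE}.
  elim: n => [|n IHn]; first by rewrite /ico_ev big_nil expg0.
  by rewrite /= !ico_ev_cons IHn expgS mulgA.
case: k => [|[|[|[|[|[|k]]]]]]; rewrite /= ?nth_nil //; apply: base.
- exact: (o 0 1 3)%N.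
- exact: (o 0 2 2)%N.
- exact: (o 1 2 5)%N.
- exact: (o 1 0 3)%N.
- exact: (o 2 0 2)%N.
- exact: (o 2 1 5)%N.
Qed.

(** The move number [kj.2] performed at position [kj.1] of [u], if possible. *)
Definition braid_step (u : seq nat) (kj : nat * nat) : seq nat :=
  let lr := nth ([::], [::]) braid_moves kj.2 in
  if prefix lr.1 (drop kj.1 u)
  then take kj.1 u ++ lr.2 ++ drop (size lr.1) (drop kj.1 u) else u.

Lemma ico_ev_braid_steps ms u : ico_ev (foldl braid_step u ms) = ico_ev u.
Proof.
elim: ms u => //= kj ms IHms u; rewrite {}IHms /braid_step.
case: ifP => // /prefixP[v uv].
rewrite -[in RHS](cat_take_drop kj.1 u) uv drop_size_cat // !ico_evM.
by rewrite ico_ev_braid.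
Qed.

End BraidMoves.

(** The Knuth-Bendix completion of the presentation of [3,5] for the order of
  words by length, then lexicographically. All the rules keep or decrease
  length, and every irreducible word is a reduced expression. *)
Definition ico_rules : seq (seq nat * seq nat) :=
  [:: ([:: 0; 0], [::]); ([:: 1; 1], [::]); ([:: 2; 2], [::]);
      ([:: 1; 0; 1], [:: 0; 1; 0]); ([:: 2; 0], [:: 0; 2]);
      ([:: 2; 1; 2; 1; 2], [:: 1; 2; 1; 2; 1]);
      ([:: 2; 1; 2; 1; 0; 2], [:: 1; 2; 1; 2; 1; 0]);
      ([:: 2; 1; 0; 2; 1; 0; 2; 1; 2; 1], [:: 1; 2; 1; 0; 2; 1; 0; 2; 1; 2]);
      ([:: 2; 1; 0; 2; 1; 0; 2; 1; 0; 2; 1; 0],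
       [:: 1; 2; 1; 0; 2; 1; 0; 2; 1; 0; 2; 1])]%N.

Lemma ico_rules_sound r : r \in ico_rules -> ico_ev r.1 = ico_ev r.2.
Proof.
have ev2 i : ico_ev [:: i; i] = 1.
  by rewrite ico_ev_cons /ico_ev big_seq1 ico_tau2.
have ev0 : 1 = ico_ev [::] by rewrite /ico_ev big_nil.
have by_braids ms u v : v = foldl braid_step u ms -> ico_ev u = ico_ev v.
  by move=> ->; rewrite ico_ev_braid_steps.
case/(nthP ([::], [::])) => k _ <-.
(* The paths of braid moves were found by searching all the words that are
   braid equivalent to the left-hand side. *)
case: k => [|[|[|[|[|[|[|[|[|k]]]]]]]]]; rewrite /= ?nth_nil ?ev2 //.
- exact: (by_braids [:: (0, 3)])%N.
- exact: (by_braids [:: (0, 4)])%N.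
- exact: (by_braids [:: (0, 5)])%N.
- exact: (by_braids [:: (4, 1); (0, 5)])%N.
- exact: (by_braids [:: (2, 1); (3, 0); (5, 2); (4, 1); (0, 5); (4, 3); (3, 4)])%N.
- exact: (by_braids [:: (2, 1); (3, 0); (8, 1); (9, 0); (5, 2); (4, 1); (9, 4);
    (0, 5); (4, 3); (3, 4)])%N.
Qed.

Definition head_rule (v : seq nat) : option (seq nat * seq nat) :=
  ohead [seq r <- ico_rules | prefix r.1 v].

Lemma head_ruleP v r : head_rule v = Some r ->
  r \in ico_rules /\ exists t, v = r.1 ++ t.
Proof.
rewrite /head_rule; set rs := filter _ _ => rsr.
have : r \in rs by case: rs rsr => //= _ l [->]; rewrite mem_head.
by rewrite mem_filter => /andP[/prefixP].
Qed.

(** Prefixes the reduced word [w] with the letter [i] and reduces the result: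
  only a prefix of [i :: w] can be reducible. The fuel [n] bounds the nesting
  of rewriting steps. *)
Fixpoint push (n i : nat) (w : seq nat) : seq nat :=
  if n is n'.+1 then
    if head_rule (i :: w) is Some r
    then foldr (push n') (drop (size r.1) (i :: w)) r.2 else i :: w
  else i :: w.

Arguments head_rule : simpl never.

Lemma ico_ev_push n i w : ico_ev (push n i w) = ico_ev (i :: w).
Proof.
elim: n i w => [//|n IHn] i w; rewrite [push _ _ _]/=.
case E: (head_rule (i :: w)) => [r|//].
have [/ico_rules_sound rE [t ->]] := head_ruleP E.
rewrite drop_size_cat // ico_evM {}rE {E}; elim: r.2 => [|j v IHv] /=.
  by rewrite {2}/ico_ev big_nil mul1g.
by rewrite IHn !ico_ev_cons IHv mulgA.
Qed.

(** No rule introduces a letter, which makes supports well behaved below. *)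
Lemma push_sub n i w : {subset push n i w <= i :: w}.
Proof.
elim: n i w => [|n IHn] i w j; rewrite [push _ _ _]/= //.
case E: (head_rule (i :: w)) => [r|//]; have [rin [t ->]] := head_ruleP E.
have : {subset r.2 <= r.1}.
  move=> k; have /allP/(_ r rin)/allP : all (fun r => all (mem r.1) r.2) ico_rules by [].
  by apply.
rewrite drop_size_cat // {rin E}; elim: r.2 j => [|k v IHv] j /= rr.
  by rewrite mem_cat orbC => ->.
move/IHn; rewrite inE => /orP[/eqP->|].
  by rewrite mem_cat rr ?mem_head.
by apply: IHv => l lv; apply: rr; rewrite inE lv orbT.
Qed.

Arguments push : simpl never.

Definition reduce (u : seq nat) : seq nat := foldr (push 16) [::] u.

Lemma ico_ev_reduce u : ico_ev (reduce u) = ico_ev u.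
Proof. by elim: u => //= i u IHu; rewrite ico_ev_push !ico_ev_cons IHu. Qed.

Lemma reduce_sub u : {subset reduce u <= u}.
Proof.
elim: u => //= i u IHu j /push_sub; rewrite !inE => /orP[->//|/IHu->].
by rewrite orbT.
Qed.

(** The irreducible words which extend a word of [L] on the left by less than
  [n] letters; every suffix of an irreducible word is irreducible. The longest
  element of [3,5] has length 15. *)
Fixpoint irreducible_words n (L : seq (seq nat)) : seq (seq nat) :=
  if n is n'.+1 then
    L ++ irreducible_words n'
      [seq i :: w | w <- L, i <- [seq i <- iota 0 3 | push 16 i w == i :: w]]
  else [::].

Definition ico_words := irreducible_words 16 [:: [::]].

(** The action of the three generators on the vertices: the base vertex is 0
  and the antipode of [x] is [11 - x]. *)
Definition vertex_table : seq (seq nat) :=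
  [:: [:: 1; 0; 2; 3; 5; 4; 7; 6; 8; 9; 11; 10];
      [:: 0; 2; 1; 4; 3; 5; 6; 8; 7; 10; 9; 11];
      [:: 0; 1; 3; 2; 6; 7; 4; 5; 9; 8; 10; 11]]%N.

(** The default row agrees with the reading of the letters above 2 by
  [ico_ev]. *)
Definition vstep (x i : nat) : nat := nth 0%N (nth (nth [::] vertex_table 0) vertex_table i) x.

Definition vact (x : nat) (u : seq nat) : nat := foldl vstep x u.

(** The vertices 0, 1, 2 form a face, and only the identity of [3,5] fixes
  all three. *)
Definition flag_key (u : seq nat) : seq nat := [:: vact 0 u; vact 1 u; vact 2 u].

Lemma size_ico_words : size ico_words = 120.
Proof. by vm_compute. Qed.
Lemma ico_words_key : uniq (map flag_key ico_words).
Proof. by vm_compute. Qed.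

Lemma ico_words_push :
  all (fun w => all (fun i => push 16 i w \in ico_words) (iota 0 3)) ico_words.
Proof. by vm_compute. Qed.

(** The stabilizer of vertex 0 is generated by the last two generators. *)
Lemma ico_words_pos : all (fun w => (vact 0 w == 0) == (0 \notin w)) ico_words.
Proof. by vm_compute. Qed.

(** For each vertex, a shortest word that moves vertex 0 to it. *)
Definition vertex_words : seq (seq nat) :=
  [:: [::]; [:: 0]; [:: 0; 1]; [:: 0; 1; 2]; [:: 0; 1; 2; 1];
      [:: 0; 1; 2; 1; 0]; [:: 0; 1; 2; 1; 2]; [:: 0; 1; 2; 1; 2; 0];
      [:: 0; 1; 2; 1; 2; 0; 1]; [:: 0; 1; 2; 1; 2; 0; 1; 2];
      [:: 0; 1; 2; 1; 2; 0; 1; 2; 1]; [:: 0; 1; 2; 1; 2; 0; 1; 2; 1; 0]]%N.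

Definition vertex_word x : seq nat := nth [::] vertex_words x.

Lemma vstep_lt x i : x < 12 -> vstep x i < 12.
Proof. by case: i => [|[|[|i]]]; rewrite /vstep /= ?nth_nil; do 12!(case: x => [//|x]). Qed.

Lemma vact_lt x u : x < 12 -> vact x u < 12.
Proof. by elim: u x => //= i u IHu x x12; apply/IHu/vstep_lt. Qed.

Lemma vact_cat x u v : vact x (u ++ v) = vact (vact x u) v.
Proof. exact: foldl_cat. Qed.

Lemma vstep_inord x i : vstep x (inord i : 'I_3) = vstep x i.
Proof.
have [i3|i3] := ltnP i 3; first by rewrite inordK.
have tableE k : 2 < k -> nth (nth [::] vertex_table 0) vertex_table k =
                         nth [::] vertex_table 0 by move=> k3; rewrite nth_default.
by rewrite /vstep (tableE i) // /inord /insubd insubF //; apply/negbTE; rewrite -leqNgt.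
Qed.

Lemma vact_ev u v x : ico_ev u = ico_ev v -> x < 12 -> vact x u = vact x v.
Proof.
suff rel (a b : seq 'I_3) : cox_rel (@linear_diagram [:: 3; 5]%N) a b ->
    forall x, x < 12 -> vact x (map val a) = vact x (map val b).
  rewrite !ico_ev_word => /cox_wordE/rel/(_ x)+ x12 => /(_ x12).
  have inord_vact w : vact x (map val [seq (inord i : 'I_3) | i <- w]) = vact x w.
    by elim: w x {x12} => //= i w IHw x; rewrite vstep_inord IHw.
  by rewrite !inord_vact.
elim=> {a b} [//|a b _ IH|a b c _ ab _ bc|a a' b b' _ aa _ bb|i|i j] {}x x12.
- by rewrite IH.
- by rewrite ab ?bc.
- by rewrite !map_cat !vact_cat aa // bb // vact_lt.
- by case: i => [[|[|[|//]]] ?]; do 12!(case: x x12 => [//|x x12]).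
- by case: i => [[|[|[|//]]] ?]; case: j => [[|[|[|//]]] ?];
    do 12!(case: x x12 => [//|x x12]).
Qed.

Definition ico_nf (g : ico_group) : seq nat := reduce (map val (cox_repr g)).

Lemma ico_ev_nf g : ico_ev (ico_nf g) = g.
Proof. by rewrite ico_ev_reduce ico_ev_repr. Qed.

Lemma reduce_words u : {in u, forall i, i < 3} -> reduce u \in ico_words.
Proof.
elim: u => [|i u IHu] u3; first by rewrite mem_head.
have uL : reduce u \in ico_words.
  by apply: IHu => j ju; apply: u3; rewrite inE ju orbT.
have /allP/(_ _ uL)/allP/(_ i) := ico_words_push; apply.
by rewrite mem_iota; apply: u3; rewrite mem_head.
Qed.

Lemma ico_nf_words g : ico_nf g \in ico_words.
Proof. by apply: reduce_words => _ /mapP[i _ ->]; apply: ltn_ord. Qed.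

Lemma ico_nf_lt g i : i \in ico_nf g -> i < 3.
Proof. by move=> /reduce_sub/mapP[j _ ->]; apply: ltn_ord. Qed.

(** Equal elements act in the same way on the vertices, so the keys show that an
  element has only one irreducible word. *)
Lemma ico_words_inj u v :
  u \in ico_words -> v \in ico_words -> ico_ev u = ico_ev v -> u = v.
Proof.
move=> uL vL uv; have keyE : flag_key u = flag_key v.
  by rewrite /flag_key !(vact_ev uv).
rewrite -(nth_index [::] uL) -(nth_index [::] vL); congr nth.
apply/eqP; rewrite -(nth_uniq [::] _ _ ico_words_key) ?size_map ?index_mem //.
by rewrite !(nth_map [::]) ?index_mem // !nth_index // keyE.
Qed.

Lemma ico_nf_ev u : {in u, forall i, i < 3} -> ico_nf (ico_ev u) = reduce u.
Proof.
move=> u3; apply: ico_words_inj (ico_nf_words _) (reduce_words u3) _.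
by rewrite ico_ev_nf ico_ev_reduce.
Qed.

Lemma ico_nf_words_id u : u \in ico_words -> ico_nf (ico_ev u) = u.
Proof. by move=> uL; apply: ico_words_inj uL _ => //; rewrite ?ico_nf_words ?ico_ev_nf. Qed.

Lemma ico_nf_sub u : {in u, forall i, i < 3} -> {subset ico_nf (ico_ev u) <= u}.
Proof. by move=> u3; rewrite ico_nf_ev //; apply: reduce_sub. Qed.

(** * [3,5] as a C-group *)

(** The generators in the irreducible word of [g]; the rules being
  support-decreasing, all expressions of [g] involve them. *)
Definition ico_supp (g : ico_group) : set 'I_3 := [set i | val i \in ico_nf g].

Lemma ico_ev_gen u (I : set 'I_3) : {in u, forall i, i < 3 /\ I (inord i)} ->
  gen_subgroup (ico_tau @` I) (ico_ev u).
Proof.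
elim: u => [|i u IHu] uI; first by rewrite /ico_ev big_nil; apply: gen_subgroup1.
rewrite ico_ev_cons; apply: gen_subgroupM.
  by apply: mem_genP; exists (inord i) => //; have [] := uI _ (mem_head _ _).
by apply: IHu => j ju; apply: uI; rewrite inE ju orbT.
Qed.

Lemma ico_supp1 : ico_supp 1 = set0.
Proof.
apply/seteqP; split=> // i.
have -> : 1 = ico_ev [::] by rewrite /ico_ev big_nil.
by rewrite /ico_supp /= ico_nf_ev.
Qed.

Lemma ico_suppM g i : ico_supp (g * ico_tau i) `<=` ico_supp g `|` [set i].
Proof.
have u3 : {in ico_nf g ++ [:: val i], forall k, k < 3}.
  by move=> k; rewrite mem_cat inE => /orP[/ico_nf_lt//|/eqP->]; apply: ltn_ord.
have gE : g * ico_tau i = ico_ev (ico_nf g ++ [:: val i]).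
  by rewrite ico_evM ico_ev_nf /ico_ev big_seq1 inord_val.
move=> j; rewrite /ico_supp /= gE => /(ico_nf_sub u3).
by rewrite mem_cat inE => /orP[|/eqP/val_inj->]; [left|right].
Qed.

Lemma ico_gen_supp g : gen_subgroup (ico_tau @` ico_supp g) g.
Proof.
rewrite -{2}(ico_ev_nf g); apply: ico_ev_gen => i ig.
by rewrite /ico_supp /= inordK ?(ico_nf_lt ig).
Qed.

Lemma ico_gen_suppE (I : set 'I_3) :
  gen_subgroup (ico_tau @` I) = [set g | ico_supp g `<=` I].
Proof. exact: gen_suppE ico_tau2 ico_supp1 ico_suppM ico_gen_supp I. Qed.

Definition ico_pos (g : ico_group) : nat := vact 0 (ico_nf g).

Lemma ico_pos_ev u : ico_pos (ico_ev u) = vact 0 u.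
Proof. by apply: vact_ev => //; rewrite ico_ev_nf. Qed.

Lemma ico_posM g h : ico_pos (g * h) = vact (ico_pos g) (ico_nf h).
Proof. by rewrite -{1}(ico_ev_nf g) -{1}(ico_ev_nf h) -ico_evM ico_pos_ev vact_cat. Qed.

Lemma ico_stabE g : face_stabilizer ico_tau ord0 g <-> ico_pos g = 0%N.
Proof.
have /allP/(_ _ (ico_nf_words g))/eqP := ico_words_pos.
rewrite /face_stabilizer ico_gen_suppE -/(ico_pos g) /= => posE; split.
  move=> sg; apply/eqP; rewrite posE; apply/negP => g0.
  by case: (sg ord0 g0).
move/eqP; rewrite posE => g0 i gi i0; move: gi; rewrite i0 /ico_supp /=.
by apply/negP.
Qed.

(** * The vertices of the icosahedron *)

Local Notation vtx := (vertex ico_tau).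
Local Notation base := (base_vertex ico_tau).

(** The number of a vertex, namely the image of 0 under an element that moves
  the base vertex to it. By [ico_stabE] it does not depend on that element,
  and it determines the vertex. *)
Definition vnum (F : vtx) : nat := ico_pos (sval (cid (face_baseP F))).

Lemma vnum_shift_base g : vnum (face_shift base g) = ico_pos g.
Proof.
rewrite /vnum; case: cid => h /= /esym/face_shift_base/ico_stabE hg.
have -> : h = h * g^-1 * g by rewrite mulgVK.
by rewrite ico_posM hg.
Qed.

Lemma vnum_lt F : vnum F < 12.
Proof. exact: vact_lt. Qed.

Lemma vnum_shift F g : vnum (face_shift F g) = vact (vnum F) (ico_nf g).
Proof.
have [h ->] := face_baseP F.
by rewrite -face_shiftM !vnum_shift_base ico_posM.
Qed.

Lemma vnum_tau F i : vnum (face_shift F (ico_tau i)) = vstep (vnum F) i.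
Proof.
rewrite vnum_shift (@vact_ev _ [:: val i]) ?vnum_lt //.
by rewrite ico_ev_nf /ico_ev big_seq1 inord_val.
Qed.

Lemma vnum_ev F u : vnum (face_shift F (ico_ev u)) = vact (vnum F) u.
Proof. by rewrite vnum_shift (@vact_ev _ u) ?vnum_lt // ico_ev_nf. Qed.

Lemma vact_nfV x g : x < 12 -> vact (vact x (ico_nf g)) (ico_nf g^-1) = x.
Proof.
move=> x12; rewrite -vact_cat (@vact_ev _ [::]) //.
by rewrite ico_evM !ico_ev_nf mulgV /ico_ev big_nil.
Qed.

Lemma vnum_inj : injective vnum.
Proof.
move=> F F'; have [g ->] := face_baseP F; have [h ->] := face_baseP F'.
rewrite !vnum_shift_base => gh; apply/face_shift_base/ico_stabE.
by rewrite ico_posM gh vact_nfV.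
Qed.

Definition vertex_of (x : nat) : vtx := face_shift base (ico_ev (vertex_word x)).

Lemma vertex_ofK x : x < 12 -> vnum (vertex_of x) = x.
Proof.
by rewrite vnum_shift_base ico_pos_ev; do 12!(case: x => [//|x]).
Qed.

Lemma vnumK F : vertex_of (vnum F) = F.
Proof. by apply: vnum_inj; rewrite vertex_ofK ?vnum_lt. Qed.

Lemma vnum_base : vnum base = 0%N.
Proof.
rewrite -(face_shift1 base) vnum_shift_base.
by have := ico_pos_ev [::]; rewrite /ico_ev big_nil.
Qed.

Lemma ico_alphaE : ico_alpha = ico_ev (flatten (nseq 5 [:: 0; 1; 2]%N)).
Proof.
rewrite /ico_alpha; elim: 5 => [|n IHn]; first by rewrite expg0 /ico_ev big_nil.
by rewrite expgS IHn /= !ico_ev_cons !mulgA.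
Qed.

Lemma vnum_alpha F : vnum (face_shift F ico_alpha) = (11 - vnum F)%N.
Proof.
have /allP/(_ (vnum F)) : all (fun x => vact x (flatten (nseq 5 [:: 0; 1; 2]%N)) == 11 - x)
  (iota 0 12) by [].
by rewrite mem_iota vnum_lt ico_alphaE vnum_ev => /(_ isT)/eqP.
Qed.

(** Multiplication by [tau_i] adds at most the letter [i] to the word which
  reaches a vertex. *)
Lemma vertex_word_step F i j :
  val j \in vertex_word (vnum (face_shift F (ico_tau i))) ->
  val j \in vertex_word (vnum F) \/ j = i.
Proof.
have /allP/(_ (vnum F)) : all (fun x => all (fun i =>
    all (mem (i :: vertex_word x)) (vertex_word (vstep x i))) (iota 0 3)) (iota 0 12).
  by [].
rewrite mem_iota vnum_lt => /(_ isT)/allP/(_ (val i)).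
rewrite mem_iota ltn_ord => /(_ isT)/allP sub; rewrite vnum_tau => /sub.
by rewrite /= inE => /orP[/eqP/val_inj ->|]; [right|left].
Qed.

Definition ico_beta : ico_group := ico_ev [:: 0; 1; 2]%N.

Lemma ico_beta_exp n : ico_beta ^+ n = ico_ev (flatten (nseq n [:: 0; 1; 2]%N)).
Proof.
elim: n => [|n IHn]; first by rewrite expg0 /ico_ev big_nil.
by rewrite expgS IHn -ico_evM.
Qed.

(** The four orbits of the stabilizer of the base vertex consist of the base
  vertex, its antipode, its neighbours and the neighbours of its antipode. The
  representatives are chosen to match the relations of the presentation; the
  last one is vertex number 9. *)
Lemma vertex_orbits F : exists m t,
  [/\ F = face_shift base (m * t), face_stabilizer ico_tau ord0 t
    & [\/ m = 1, m = ico_alpha, m = ico_tau (inord 0) | m = ico_beta ^+ 3]].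
Proof.
pose ms := [:: [::]; flatten (nseq 5 [:: 0; 1; 2]%N); [:: 0%N]; flatten (nseq 3 [:: 0; 1; 2]%N)].
have /allP/(_ (vnum F)) : all (fun x => has (fun m => has (fun t =>
    (vact 0 t == 0) && (vact 0 (m ++ t) == x)) ico_words) ms) (iota 0 12).
  by vm_compute.
rewrite mem_iota vnum_lt => /(_ isT)/hasP[m mms /hasP[t _ /andP[/eqP t0 /eqP mt]]].
exists (ico_ev m), (ico_ev t); split.
- by apply: vnum_inj; rewrite -ico_evM vnum_shift_base ico_pos_ev.
- by apply/ico_stabE; rewrite ico_pos_ev.
move: mms; rewrite ico_alphaE ico_beta_exp !inE => /or4P[]/eqP ->.
- by constructor 1; rewrite /ico_ev big_nil.
- by constructor 2.
- by constructor 3; rewrite /ico_ev big_seq1.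
- by constructor 4.
Qed.

Lemma ico_tau_neq1 i : ico_tau i <> 1.
Proof.
have ev1 : 1 = ico_ev [::] by rewrite /ico_ev big_nil.
have -> : ico_tau i = ico_ev [:: val i] by rewrite /ico_ev big_seq1 inord_val.
rewrite ev1 => /vact_ev fix_all.
have := (fix_all 0%N isT, fix_all 1%N isT, fix_all 2%N isT).
by case: i {fix_all} => [[|[|[|//]]] ?] /= [[]].
Qed.

(** The order is bounded from below by the orbit of the vertex [x]. *)
Lemma ico_order u x n : ico_ev u ^+ n = 1 -> x < 12 -> 0 < n ->
    all (fun k => vact x (flatten (nseq k u)) != x) (iota 1 n.-1) ->
  has_order (ico_ev u) n.
Proof.
move=> un x12 n_gt0 /allP ux; split=> // k /andP[k_gt0 kn].
have -> : ico_ev u ^+ k = ico_ev (flatten (nseq k u)).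
  elim: k {k_gt0 kn} => [|k IHk]; first by rewrite expg0 /ico_ev big_nil.
  by rewrite expgS IHk -ico_evM.
have ev1 : 1 = ico_ev [::] by rewrite /ico_ev big_nil.
rewrite ev1 => /vact_ev/(_ x12)/eqP; apply/negP/ux.
by rewrite mem_iota k_gt0 add1n prednK.
Qed.

(* These are large computations, which unification must not start when it
   compares vertex numbers. *)
Opaque ico_words vnum ico_nf.

Lemma ico_card : exists f : 'I_120 -> ico_group, bijective f.
Proof.
exists (fun i => ico_ev (nth [::] ico_words i)).
have idx g : index (ico_nf g) ico_words < 120.
  by rewrite -size_ico_words index_mem ico_nf_words.
exists (fun g => Ordinal (idx g)) => [i|g].
  apply: val_inj => /=; rewrite ico_nf_words_id ?mem_nth ?size_ico_words //.
  by rewrite index_uniq ?size_ico_words // (map_uniq ico_words_key).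
by rewrite /= nth_index ?ico_nf_words // ico_ev_nf.
Qed.

(** * Dihedral groups *)

Section DihedralWords.
Variables (H : groupType) (s : nat) (a b : H).
Hypotheses (s_gt0 : 0 < s) (a2 : a * a = 1) (b2 : b * b = 1) (abs : (a * b) ^+ s = 1).

Definition dih_word (k : nat) (e : bool) : H := (a * b) ^+ k * a ^+ e.

(** Right multiplication by [a] changes [e], and that by [b] changes [e] and
  moves [k] by one, as [b = (a * b)^-1 * a]. *)
Lemma dih_wordP z :
  gen_subgroup [set a; b] z -> exists k e, k < s /\ z = dih_word k e.
Proof.
suff nf w : gen_subgroup [set a; b] w -> exists k e, w = dih_word k e.
  move=> /nf[k [e ->]]; exists (k %% s)%N, e; rewrite ltn_pmod //; split=> //.
  by rewrite /dih_word {1}(divn_eq k s) expgnDr mulnC expgnA abs expg1n mul1g.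
move: w; apply: gen_involutions_ind => [_ [->|->] //||_ _ [k [e ->]] [->|->]].
- by exists 0%N, false; rewrite /dih_word !expg0 mulg1.
- exists k, (~~ e); rewrite /dih_word -mulgA; congr (_ * _).
  by case: e; rewrite /= ?expg0 ?expg1 ?a2 ?mul1g.
case: e; first by exists k.+1, false; rewrite /dih_word expg1 expg0 mulg1 expgSr -mulgA.
(* The exponent is raised by [s] so that it may be decreased. *)
exists (k + s).-1, true; rewrite /dih_word expg0 mulg1 expg1.
apply: (@mulIg _ b); rewrite -[LHS]mulgA b2 mulg1 -[RHS]mulgA -expgSr.
by rewrite prednK ?addn_gt0 ?s_gt0 ?orbT // expgnDr abs mulg1.
Qed.

End DihedralWords.

Lemma morphism_dih_word (G H : groupType) (f : G -> H) a b k e :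
  {morph f : x y / x * y} ->
  f (dih_word a b k e) = dih_word (f a) (f b) k e.
Proof. by move=> fM; rewrite /dih_word fM !(morphismX fM) fM. Qed.

Lemma mem_gen_subgroup (gT : finGroupType) (A : {set gT}) (z : gT) :
  z \in <<A>>%g -> gen_subgroup [set` A] z.
Proof.
case/gen_prodgP => n [c cA ->].
apply: (big_ind (fun w : gT => gen_subgroup [set` A] w)) => [|u v|i _].
- exact: gen_subgroup1.
- exact: gen_subgroupM.
- by apply: mem_genP; apply: cA.
Qed.

Lemma dihedral_involutions s : 2 <= s ->
  exists x y : 'D_(2 * s)%N,
  [/\ x * x = 1, y * y = 1, (x * y) ^+ s = 1 & gen_subgroup [set x; y] = setT].
Proof.
move=> s2; rewrite mul2n.
have := Grp'_dihedral s2 [set: 'D_s.*2]%G; rewrite homg_refl => /esym/existsP[[x y]] /=.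
rewrite !xpair_eqE => /and4P[/eqP xyT /eqP x2 /eqP y2 /eqP xys].
exists x, y; split=> //; apply/seteqP; split=> // z _.
have /mem_gen_subgroup : z \in <<[set x; y]%SET>>%g.
  suff /fintype.subsetP : ('D_s.*2 \subset <<[set x; y]%SET>>)%g by apply; rewrite finset.inE.
  by rewrite -xyT join_subG !cycle_subG !mem_gen // !finset.inE eqxx ?orbT.
by apply: gen_subgroupS => w /=; rewrite !finset.inE => /orP[]/eqP ->; [left|right].
Qed.

Lemma card_dihedral2 s : 2 <= s -> #|'D_(2 * s)%N| = (2 * s)%N.
Proof. by move=> s2; rewrite mul2n card_dihedral. Qed.

Section DihedralNormalForm.
Variables (s : nat) (x y : 'D_(2 * s)%N).
Hypotheses (s2 : 2 <= s) (xx : x * x = 1) (yy : y * y = 1) (xys : (x * y) ^+ s = 1).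
Hypothesis xyT : gen_subgroup [set x; y] = setT.

(** The [2 * s] normal forms exhaust a group of order [2 * s], so they are
  pairwise distinct. *)
Lemma dih_word_inj k l e f :
  k < s -> l < s -> dih_word x y k e = dih_word x y l f -> k = l /\ e = f.
Proof.
move=> ks ls; pose w (u : 'I_s * bool) := dih_word x y u.1 u.2.
have s_gt0 : 0 < s by apply: leq_trans s2.
have w_surj z : exists u, w u = z.
  have [|m [h [ms ->]]] := dih_wordP s_gt0 xx yy xys (z := z); first by rewrite xyT.
  by exists (Ordinal ms, h).
pose T := finset.setTfor ('I_s * bool)%type.
have /imset_injP w_inj : #|w @: T| == #|T|.
  rewrite eqn_leq leq_imset_card /= cardsT card_prod card_ord card_bool mulnC.
  rewrite -[X in X <= _](card_dihedral2 s2).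
  apply/subset_leq_card/fintype.subsetP => z _; have [u <-] := w_surj z.
  by rewrite imset_f // finset.in_setT.
have := w_inj (Ordinal ks, e) (Ordinal ls, f).
by rewrite !finset.in_setT => /(_ isT isT) + /[dup] => /[apply] -[].
Qed.

End DihedralNormalForm.

(** * Products of Coxeter groups *)

Lemma commute_involutions (G : groupType) (x y : G) :
  x * x = 1 -> y * y = 1 -> (x * y) ^+ 2 = 1 -> commute x y.
Proof.
move=> xx yy; rewrite expg2 => /mulg1_eq/esym; rewrite invgM.
by rewrite (mulg1_eq xx) (mulg1_eq yy).
Qed.

Section CoxeterClasses.
Variables (I : choiceType) (m : I -> I -> nat).

(** Letters of two classes that commute with each other can be sorted by class
  without changing the element. *)
Lemma cox_word_filter (P : pred I) u :
    (forall i j, P i -> ~~ P j -> m i j = 2) ->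
  cox_word m u = cox_word m (filter P u) * cox_word m (filter (predC P) u).
Proof.
move=> mP; elim: u => [|i u IHu] /=; first by rewrite mulg1.
rewrite cox_word_cons IHu; case: ifP => Pi /=; first by rewrite cox_word_cons mulgA.
rewrite cox_word_cons !mulgA; congr (_ * _).
have {IHu} : all P (filter P u) by apply: filter_all.
elim: (filter P u) => [|j v IHv] /=; first by rewrite mulg1 mul1g.
case/andP=> Pj /IHv vi; rewrite cox_word_cons -mulgA -vi !mulgA; congr (_ * _).
apply/commute_involutions; rewrite ?cox_gen2 //.
apply: (@conjg_inj _ (cox_gen m i)); rewrite conj1g conjXg conjMg.
rewrite (_ : _ ^ _ * _ ^ _ = cox_gen m j * cox_gen m i) -?(mP j i) ?Pi //.
  exact: cox_gen_order.
rewrite -conjMg conjgE (mulg1_eq (cox_gen2 m i)) !mulgA cox_gen2 mul1g.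
by [].
Qed.

Lemma cox_word_classes (pr : I -> nat) n u :
    (forall i j, pr i != pr j -> m i j = 2) -> all (fun i => pr i < n) u ->
  cox_word m u = \prod_(0 <= p < n) cox_word m [seq i <- u | pr i == p].
Proof.
move=> mpr; elim: n u => [|n IHn] u un.
  by rewrite big_nil; case: u un.
rewrite big_nat_recr //= (@cox_word_filter (fun i => pr i < n)); last first.
  by move=> i j ni; rewrite -leqNgt => nj; apply/mpr; rewrite neq_ltn (leq_trans ni).
congr (_ * cox_word m _); last first.
  apply: eq_in_filter => i /(allP un) /=; rewrite ltnS -leqNgt eqn_leq => -> //.
rewrite IHn ?filter_all //; apply: eq_big_nat => p pn.
rewrite -filter_predI; congr cox_word; apply: eq_filter => i /=.
by case: eqP => // ->; rewrite pn.
Qed.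

End CoxeterClasses.

Section VertexGroup.
Variable s : nat.
Hypothesis s2 : 2 <= s.

Local Notation V := (vertex ico_tau).
Local Notation W := (vertex_coxeter ico_tau ico_alpha s).
Local Notation diag := (antipodal_diagram ico_alpha s).
Local Notation sigma := (@vertex_gen _ _ ico_tau ico_alpha s).
Local Notation antip F := (face_shift F ico_alpha).

(** The six dihedral factors are numbered by the smaller number of an antipodal
  pair, and the vertex with that number is the positive one. *)
Definition pair_index (F : V) : nat := minn (vnum F) (11 - vnum F).
Definition positive (F : V) : bool := vnum F < 6.

Lemma pair_index_lt F : pair_index F < 6.
Proof.
have /allP/(_ (vnum F)) : all (fun x => minn x (11 - x) < 6) (iota 0 12) by [].
by rewrite mem_iota vnum_lt => /(_ isT).
Qed.

Definition pair_ord F : 'I_6 := Ordinal (pair_index_lt F).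

Lemma pair_index_antip F : pair_index (antip F) = pair_index F.
Proof.
rewrite /pair_index vnum_alpha minnC; congr minn.
by rewrite subKn; last exact: vnum_lt.
Qed.

Lemma positive_antip F : positive (antip F) = ~~ positive F.
Proof.
have /allP/(_ (vnum F)) : all (fun x => (11 - x < 6) == ~~ (x < 6)) (iota 0 12) by [].
by rewrite mem_iota vnum_lt /positive vnum_alpha => /(_ isT)/eqP.
Qed.

Lemma pair_indexP F F' : pair_index F = pair_index F' -> F' = F \/ F' = antip F.
Proof.
move=> FF'; suff [e|e] : vnum F' = vnum F \/ vnum F' = (11 - vnum F)%N.
- by left; apply: vnum_inj.
- by right; apply: vnum_inj; rewrite vnum_alpha.
have /allP/(_ (vnum F)) : all (fun x => all (fun y => (minn x (11 - x) == minn y (11 - y))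
  ==> (y == x) || (y == 11 - x)) (iota 0 12)) (iota 0 12) by [].
rewrite mem_iota vnum_lt => /(_ isT)/allP/(_ (vnum F')).
rewrite mem_iota vnum_lt => /(_ isT)/implyP.
by rewrite -/(pair_index F) FF' => /(_ (eqxx _))/orP[]/eqP; [left|right].
Qed.

Lemma diag_pair F F' : pair_index F != pair_index F' -> diag F F' = 2.
Proof.
move=> FF'; rewrite /antipodal_diagram ifN //.
by apply: contraNneq FF' => ->; rewrite pair_index_antip.
Qed.

Lemma sigma2 F : sigma F * sigma F = 1. Proof. exact: cox_gen2. Qed.

Variables (x y : 'D_(2 * s)%N).
Hypotheses (xx : x * x = 1) (yy : y * y = 1) (xys : (x * y) ^+ s = 1).
Hypothesis xyT : gen_subgroup [set x; y] = setT.

Definition vertex_involution F := if positive F then x else y.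

Definition coordinate (p : 'I_6) (d : 'D_(2 * s)%N) : dihedral_power s 6 :=
  [ffun q => if q == p then d else 1].

Lemma coordinateM p : {morph coordinate p : d e / d * e}.
Proof.
move=> d e; apply/ffunP => q; rewrite !ffunE.
by case: eqP => // _; rewrite mulg1.
Qed.

(** Each vertex acts on the coordinate of its antipodal pair only, and the two
  vertices of a pair go to the two involutions that generate the dihedral
  group. *)
Definition vertex_iso : W -> dihedral_power s 6 :=
  @cox_lift _ diag _ (fun F => coordinate (pair_ord F) (vertex_involution F)).

Lemma vertex_involution2 F : vertex_involution F * vertex_involution F = 1.
Proof. by rewrite /vertex_involution; case: positive. Qed.

Lemma yxs : (y * x) ^+ s = 1.
Proof.
have -> : y * x = (x * y)^-1 by rewrite invgM (mulg1_eq xx) (mulg1_eq yy).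
by rewrite expVgn xys invg1.
Qed.

Fact vertex_iso_involution F :
  coordinate (pair_ord F) (vertex_involution F) *
  coordinate (pair_ord F) (vertex_involution F) = 1.
Proof. by rewrite -coordinateM vertex_involution2 (morphism1 (coordinateM _)). Qed.

Fact vertex_iso_order F F' :
  (coordinate (pair_ord F) (vertex_involution F) *
   coordinate (pair_ord F') (vertex_involution F')) ^+ diag F F' = 1.
Proof.
have [FF'|FF'] := eqVneq (pair_index F) (pair_index F').
  have -> : pair_ord F' = pair_ord F by apply: val_inj.
  rewrite -coordinateM -(morphismX (coordinateM _)).
  rewrite -[RHS](morphism1 (coordinateM (pair_ord F))); congr coordinate.
  case: (pair_indexP FF') => ->; last first.
    rewrite /antipodal_diagram eqxx /vertex_involution positive_antip.
    by case: positive; rewrite ?xys ?yxs.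
  by rewrite vertex_involution2 expg1n.
rewrite diag_pair // expg2.
set a := coordinate _ _; set b := coordinate _ _.
have ab : commute a b.
  apply/ffunP => q; rewrite !ffunE; case: eqP => [->|]; case: eqP; rewrite ?mulg1 ?mul1g //.
  by move=> /(congr1 val) /= e; rewrite e eqxx in FF'.
by rewrite mulgA -(mulgA a) -ab mulgA vertex_iso_involution mul1g vertex_iso_involution.
Qed.

Lemma vertex_isoM : {morph vertex_iso : v w / v * w}.
Proof. exact: cox_liftM vertex_iso_involution vertex_iso_order. Qed.

Lemma vertex_iso_gen F :
  vertex_iso (sigma F) = coordinate (pair_ord F) (vertex_involution F).
Proof. exact: cox_lift_gen vertex_iso_involution vertex_iso_order F. Qed.

Lemma vertex_iso_at u p :
  vertex_iso (cox_word diag u) p =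
  \prod_(F <- u | pair_index F == p) vertex_involution F.
Proof.
have atM : {morph (fun f : dihedral_power s 6 => f p) : f g / f * g}.
  by move=> f g; rewrite ffunE.
rewrite /vertex_iso (cox_lift_word vertex_iso_involution vertex_iso_order).
rewrite (morphism_prod atM) [RHS]big_mkcond; apply: eq_bigr => F _.
by rewrite ffunE -val_eqE eq_sym.
Qed.

(** The factor of the word [u] in the dihedral group of the pair number [p]. *)
Definition pair_part (p : nat) (u : seq V) : W :=
  cox_word diag [seq F <- u | pair_index F == p].

Lemma pair_part_prod u : cox_word diag u = \prod_(0 <= p < 6) pair_part p u.
Proof.
apply: cox_word_classes; first exact: diag_pair.
by apply/allP => F _; apply: pair_index_lt.
Qed.

Lemma vertex_iso_part u (p : 'I_6) :
  vertex_iso (pair_part p u) p = vertex_iso (cox_word diag u) p.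
Proof.
rewrite !vertex_iso_at big_filter_cond; apply: eq_bigl => F.
by rewrite andbb.
Qed.

Lemma sigma_antip_order F : (sigma F * sigma (antip F)) ^+ s = 1.
Proof.
have e : diag F (antip F) = s by rewrite /antipodal_diagram eqxx.
by have := cox_gen_order diag F (antip F); rewrite e.
Qed.

Lemma pair_part_dih F u : exists k e,
  k < s /\ pair_part (pair_index F) u = dih_word (sigma F) (sigma (antip F)) k e.
Proof.
apply: dih_wordP; rewrite ?sigma2 ?sigma_antip_order //; first exact: leq_trans s2.
have : all (fun E => pair_index E == pair_index F)
         [seq E <- u | pair_index E == pair_index F] by apply: filter_all.
rewrite /pair_part; elim: (filter _ u) => [|E v IHv] /=.
  by move=> _; apply: gen_subgroup1.
case/andP=> /eqP EF /IHv gv; rewrite cox_word_cons; apply: gen_subgroupM => //.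
by apply: mem_genP; case: (pair_indexP (esym EF)) => ->; [left|right].
Qed.

Lemma vertex_iso_dih F k e :
  vertex_iso (dih_word (sigma F) (sigma (antip F)) k e) =
  coordinate (pair_ord F)
    (dih_word (vertex_involution F) (vertex_involution (antip F)) k e).
Proof.
rewrite (morphism_dih_word _ _ _ _ vertex_isoM) !vertex_iso_gen.
have -> : pair_ord (antip F) = pair_ord F by apply/val_inj/pair_index_antip.
by rewrite -(morphism_dih_word _ _ _ _ (coordinateM _)).
Qed.

Definition positive_vertex (p : 'I_6) : V := vertex_of p.

Lemma positive_vertexP p :
  pair_index (positive_vertex p) = p /\ positive (positive_vertex p).
Proof.
rewrite /pair_index /positive /positive_vertex !vertex_ofK; last first.
  by apply: leq_trans (ltn_ord p) _.
by split; [case: p; do 6!case=> // | apply: ltn_ord].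
Qed.

Lemma positive_involution F : positive F ->
  vertex_involution F = x /\ vertex_involution (antip F) = y.
Proof. by move=> F0; rewrite /vertex_involution positive_antip F0. Qed.

(** A pair part is a dihedral normal form, hence is determined by its image. *)
Lemma pair_part_inj (p : 'I_6) u v :
  vertex_iso (cox_word diag u) p = vertex_iso (cox_word diag v) p ->
  pair_part p u = pair_part p v.
Proof.
have [Fp /positive_involution[Fx Fy]] := positive_vertexP p.
move: (positive_vertex p) => F in Fp Fx Fy *.
have {Fp} -> : p = pair_ord F by apply: val_inj.
rewrite -(vertex_iso_part u) -(vertex_iso_part v) /=.
have [k [e [ks ->]]] := pair_part_dih F u; have [l [f [ls ->]]] := pair_part_dih F v.
rewrite !vertex_iso_dih Fx Fy !ffunE eqxx.
by case/(dih_word_inj s2 xx yy xys xyT ks ls) => -> ->.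
Qed.

Lemma vertex_iso_inj : injective vertex_iso.
Proof.
apply: (morphism_inj vertex_isoM) => w; rewrite -(cox_reprK w); move: (cox_repr w) => u u1.
rewrite pair_part_prod big_mkord big1 // => p _.
rewrite (@pair_part_inj p u [::]) // u1.
by rewrite cox_word1 (morphism1 vertex_isoM).
Qed.

Lemma vertex_iso_surj f : exists w, vertex_iso w = f.
Proof.
have coord p : exists w, vertex_iso w = coordinate p (f p).
  have [Fp /positive_involution[Fx Fy]] := positive_vertexP p.
  have [|||||k [e [_ ->]]] := @dih_wordP _ s x y _ _ _ _ (f p) => //.
  - exact: leq_trans s2.
  - by rewrite xyT.
  exists (dih_word (sigma (positive_vertex p)) (sigma (antip (positive_vertex p))) k e).
  by rewrite vertex_iso_dih Fx Fy; congr coordinate; apply: val_inj.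
have [w wE] := choice coord; exists (\prod_(p < 6) w p).
rewrite (morphism_prod vertex_isoM) (eq_bigr _ (fun p _ => wE p)).
apply/ffunP => q.
have atM : {morph (fun f : dihedral_power s 6 => f q) : f g / f * g}.
  by move=> g h; rewrite ffunE.
rewrite (morphism_prod atM); transitivity (\prod_(p | p == q) f p); last first.
  by rewrite big_pred1_eq.
by rewrite [RHS]big_mkcond; apply: eq_bigr => p _; rewrite ffunE eq_sym; case: eqP => // ->.
Qed.

Lemma vertex_isoP : group_iso vertex_iso.
Proof.
split; first exact: vertex_isoM.
have [g gE] := choice vertex_iso_surj; exists g => // w.
exact/vertex_iso_inj.
Qed.

(** * Supports in W *)

(** The vertices [F] such that every expression of [w] involves [sigma F]. The
  definition needs no normal form, and so is visibly compatible with the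
  action of [3,5]. *)
Definition vertex_supp (w : W) : set V :=
  [set F | ~ gen_subgroup (sigma @` [set~ F]) w].

Lemma vertex_supp1 : vertex_supp 1 = set0.
Proof. by apply/seteqP; split=> // F; case; apply: gen_subgroup1. Qed.

Lemma vertex_suppM w F : vertex_supp (w * sigma F) `<=` vertex_supp w `|` [set F].
Proof.
move=> E /= wF; have [->|EF] := pselect (E = F); first by right.
left=> wE; apply: wF; apply: gen_subgroupM => //; apply: mem_genP.
by exists F => // FE; apply: EF.
Qed.

(** If [w] can be written without [sigma F], then its coordinate at the pair of
  [F] is a product of copies of a single involution. *)
Lemma vertex_supp_missing w F : ~ vertex_supp w F ->
  vertex_iso w (pair_ord F) = 1 \/
  vertex_iso w (pair_ord F) = vertex_involution (antip F).
Proof.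
move/contrapT; move: w; apply: gen_involutions_ind => [_ [E _ <-]||].
- exact: sigma2.
- by left; rewrite (morphism1 vertex_isoM) ffunE.
move=> w _ wF [E /= EF <-]; rewrite vertex_isoM vertex_iso_gen !ffunE.
case: eqP => [/(congr1 val)/= FE|_]; last by rewrite mulg1.
case: (pair_indexP FE) => [//|->].
by case: wF => ->; [right; rewrite mul1g | left; rewrite vertex_involution2].
Qed.

Lemma vertex_involution_neq F :
  vertex_involution F != 1 /\ vertex_involution F != vertex_involution (antip F).
Proof.
have inj := dih_word_inj s2 xx yy xys xyT.
have s_gt0 : 0 < s by apply: leq_trans s2.
have dx : dih_word x y 0 true = x by rewrite /dih_word expg0 mul1g expg1.
have dxy : dih_word x y 1 false = x * y by rewrite /dih_word expg0 mulg1 expg1.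
have d1 : dih_word x y 0 false = 1 by rewrite /dih_word !expg0 mulg1.
have x1 : x != 1.
  by apply/eqP; rewrite -dx -d1 => /(inj _ _ _ _ s_gt0 s_gt0)[].
have xy : x != y.
  by apply/eqP => xy; move: xx; rewrite {2}xy -dxy -d1 => /(inj _ _ _ _ s2 s_gt0)[].
have y1 : y != 1.
  apply/eqP => y1; have e : dih_word x y 1 false = dih_word x y 0 true.
    by rewrite dxy dx y1 mulg1.
  by case: (inj _ _ _ _ s2 s_gt0 e).
rewrite /vertex_involution positive_antip.
by case: positive; rewrite ?x1 ?y1 // eq_sym.
Qed.

Lemma sigma_inj : injective sigma.
Proof.
move=> F F' /(congr1 vertex_iso); rewrite !vertex_iso_gen => e.
have := congr1 (fun f : dihedral_power s 6 => f (pair_ord F)) e.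
have [n1 n2] := vertex_involution_neq F; rewrite !ffunE eqxx.
case: eqP => [/(congr1 val)/= FF' /eqP|_ /eqP]; last by rewrite (negPf n1).
by case: (pair_indexP FF') => -> //; rewrite (negPf n2).
Qed.

Lemma sigma_neq1 F : sigma F != 1.
Proof.
apply/eqP => /(congr1 vertex_iso); rewrite vertex_iso_gen (morphism1 vertex_isoM).
move=> /(congr1 (fun f : dihedral_power s 6 => f (pair_ord F))).
have [n1 _] := vertex_involution_neq F.
by rewrite !ffunE eqxx => /eqP; rewrite (negPf n1).
Qed.

(** It suffices to generate each pair part of [w] by the support. If a vertex of
  the pair is missing from the support, the part is trivial or is the
  generator of the other vertex; in the second case that vertex is in the
  support, as the two involutions differ from each other and from 1. *)
Lemma vertex_gen_supp w : gen_subgroup (sigma @` vertex_supp w) w.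
Proof.
rewrite -{2}(cox_reprK w) -/diag; set u := cox_repr w.
have wE : cox_word diag u = w by apply: cox_reprK.
have miss F : ~ vertex_supp w F -> gen_subgroup (sigma @` vertex_supp w) (pair_part (pair_index F) u).
  move=> nF; have F1 : vertex_iso (cox_word diag u) (pair_ord F) = 1 ->
      gen_subgroup (sigma @` vertex_supp w) (pair_part (pair_index F) u).
    move=> u1; rewrite (@pair_part_inj (pair_ord F) u [::]); first exact: gen_subgroup1.
    by rewrite u1 cox_word1 (morphism1 vertex_isoM) ffunE.
  have [wF|wF'] := vertex_supp_missing nF; first by apply: F1; rewrite wE.
  have -> : pair_part (pair_index F) u = sigma (antip F).
    rewrite (@pair_part_inj (pair_ord F) u [:: antip F]).
      by rewrite /pair_part /= pair_index_antip eqxx.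
    rewrite wE wF' -[cox_word _ _]/(sigma (antip F)) vertex_iso_gen ffunE.
    by rewrite -val_eqE /= pair_index_antip eqxx.
  apply: mem_genP; exists (antip F) => //; apply: contrapT => nF'.
  have [n1 n2] := vertex_involution_neq (antip F); have := vertex_supp_missing nF'.
  have -> : pair_ord (antip F) = pair_ord F by apply/val_inj/pair_index_antip.
  by rewrite wF' => -[] e; [rewrite e eqxx in n1 | rewrite -e eqxx in n2].
rewrite pair_part_prod big_mkord.
apply: (big_ind (gen_subgroup (sigma @` vertex_supp w))) => [|v v'|p _].
- exact: gen_subgroup1.
- exact: gen_subgroupM.
have [pE _] := positive_vertexP p; set F := positive_vertex p in pE; rewrite -pE.
have [sF|/miss//] := pselect (vertex_supp w F).
have [sF'|/miss] := pselect (vertex_supp w (antip F)); last by rewrite pair_index_antip.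
have [k [e [_ ->]]] := pair_part_dih F u.
have pow v n : gen_subgroup (sigma @` vertex_supp w) v ->
    gen_subgroup (sigma @` vertex_supp w) (v ^+ n).
  move=> gv; elim: n => [|n IHn]; first by rewrite expg0; apply: gen_subgroup1.
  by rewrite expgS; apply: gen_subgroupM.
apply: gen_subgroupM; apply: pow; last by apply: mem_genP; exists F.
by apply: gen_subgroupM; apply: mem_genP; [exists F | exists (antip F)].
Qed.

Lemma vertex_supp_shift w F g :
  vertex_supp (vertex_action ico_central_symmetry s w g) F ->
  vertex_supp w (face_shift F g^-1).
Proof.
move=> wF gw; apply: wF.
apply: (gen_morphism (f := (vertex_action ico_central_symmetry s)^~ g)) gw.
  exact: (wact_morph (vertex_action ico_central_symmetry s)).
move=> _ [E /= EF <-].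
change (gen_subgroup (sigma @` [set~ F]) (vertex_action ico_central_symmetry s (sigma E) g)).
rewrite (vertex_action_gen ico_central_symmetry s E g); apply: mem_genP.
exists (face_shift E g) => // EgF; apply: EF.
by rewrite -EgF -face_shiftM mulgV face_shift1.
Qed.

End VertexGroup.

(** * The group of the polytope *)

Section PowerGroup.
Variable s : nat.
Hypothesis s2 : 2 <= s.

Local Notation sym := ico_central_symmetry.
Local Notation V := (vertex ico_tau).
Local Notation W := (vertex_coxeter ico_tau ico_alpha s).
Local Notation act := (vertex_action sym s).
Local Notation P := (power_group sym s).
Local Notation rho := (@power_gen _ _ ico_tau ico_alpha sym s).
Local Notation sigma := (@vertex_gen _ _ ico_tau ico_alpha s).
Local Notation base := (base_vertex ico_tau).
Local Notation inl := (sd_left act).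
Local Notation inr := (sd_right act).

Lemma rho0E : rho ord0 = inr (sigma base).
Proof. by rewrite /power_gen unlift_none. Qed.

Lemma rho_liftE j : rho (lift ord0 j) = inl (ico_tau j).
Proof. by rewrite /power_gen liftK. Qed.

Lemma vertex_supp_gen w : gen_subgroup (sigma @` vertex_supp w) w.
Proof.
have [x [y [xx yy xys xyT]]] := dihedral_involutions s2.
exact: (vertex_gen_supp s2 xx yy xys xyT).
Qed.

Lemma vertex_gen_neq1 F : sigma F != 1.
Proof.
have [x [y [xx yy xys xyT]]] := dihedral_involutions s2.
exact: (sigma_neq1 s2 xx yy xys xyT).
Qed.

Lemma vertex_gen_inj : injective sigma.
Proof.
have [x [y [xx yy xys xyT]]] := dihedral_involutions s2.
exact: (sigma_inj s2 xx yy xys xyT).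
Qed.

Lemma sigma_conj F g : inr (sigma F) ^ inl g = inr (sigma (face_shift F g)).
Proof. by rewrite sd_conj vertex_action_gen. Qed.

(** The generators needed to write [x.1 * x.2]: those of [x.1], the first one if
  [x.2] is nontrivial, and those which move the base vertex to the vertices in
  the support of [x.2]. *)
Definition power_supp (x : P) : set 'I_4 :=
  [set i | if unlift ord0 i is Some j
           then ico_supp x.1 j \/
                exists2 F, vertex_supp x.2 F & val j \in vertex_word (vnum F)
           else x.2 <> 1].

Lemma power_supp0 x : power_supp x ord0 <-> x.2 <> 1.
Proof. by rewrite /power_supp /= unlift_none. Qed.

Lemma power_supp_lift x j : power_supp x (lift ord0 j) <->
  ico_supp x.1 j \/ exists2 F, vertex_supp x.2 F & val j \in vertex_word (vnum F).
Proof. by rewrite /power_supp /= liftK. Qed.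

Lemma rho2 i : rho i * rho i = 1.
Proof.
case: (unliftP ord0 i) => [j ->|->]; first by rewrite rho_liftE -sd_leftM ico_tau2.
by rewrite rho0E -sd_rightM sigma2.
Qed.

Lemma rho_neq1 i : rho i != 1.
Proof.
case: (unliftP ord0 i) => [j ->|->]; apply/eqP; rewrite ?rho_liftE ?rho0E.
  by move=> /(congr1 fst) /=; apply: ico_tau_neq1.
by move=> /(congr1 snd) /= /eqP; apply/negP/vertex_gen_neq1.
Qed.

Lemma power_supp1 : power_supp 1 = set0.
Proof.
apply/seteqP; split=> // i; case: (unliftP ord0 i) => [j ->|->].
  by case/power_supp_lift => /=; [rewrite ico_supp1 | rewrite vertex_supp1 => -[]].
by move/power_supp0.
Qed.

Lemma power_suppM x i : power_supp (x * rho i) `<=` power_supp x `|` [set i].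
Proof.
move=> k; case: (unliftP ord0 i) => [j ->|->].
  rewrite rho_liftE sd_mul_left; case: (unliftP ord0 k) => [l ->|->]; last first.
    move/power_supp0 => wj; left; apply/power_supp0 => w1; apply: wj.
    exact: etrans (congr1 (act^~ (ico_tau j)) w1) (wact_one act _).
  case/power_supp_lift => [/ico_suppM[|/= ->]|[F /vertex_supp_shift wF]].
  - by left; apply/power_supp_lift; left.
  - by right.
  rewrite -{1}(face_shift1 F) -(mulVg (ico_tau j)) face_shiftM.
  move=> /vertex_word_step[lF|->]; last by right.
  by left; apply/power_supp_lift; right; exists (face_shift F (ico_tau j)^-1).
rewrite rho0E sd_mul_right; case: (unliftP ord0 k) => [l ->|->]; last by right.
case/power_supp_lift => [|[F /vertex_suppM[wF|/= ->]]].
- by left; apply/power_supp_lift; left.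
- by left; apply/power_supp_lift; right; exists F.
by rewrite vnum_base.
Qed.

(** The generator of a vertex is the conjugate of [rho_0] by an element that
  moves the base vertex to it. *)
Lemma power_gen_supp x : gen_subgroup (rho @` power_supp x) x.
Proof.
have tau_gen (I : set 'I_3) u : gen_subgroup (ico_tau @` I) u ->
    (forall j, I j -> power_supp x (lift ord0 j)) ->
    gen_subgroup (rho @` power_supp x) (inl u).
  move=> uI Ix; apply: gen_morphism (sd_leftM act) _ _ uI => _ [j /Ix xj <-].
  by apply: mem_genP; exists (lift ord0 j); rewrite ?rho_liftE.
rewrite [X in gen_subgroup _ X]sd_split; apply: gen_subgroupM.
  apply: (tau_gen _ _ (@ico_gen_supp x.1)) => j xj.
  by apply/power_supp_lift; left.
apply: gen_morphism (sd_rightM act) _ _ (@vertex_supp_gen x.2) => _ [F xF <-].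
rewrite -(vnumK F) /vertex_of -sigma_conj -rho0E; apply: gen_subgroupJ.
  apply: mem_genP; exists ord0 => //; apply/power_supp0 => x1.
  by move: xF; rewrite x1 vertex_supp1.
apply: (tau_gen [set j : 'I_3 | val j \in vertex_word (vnum F)] _ _).
  apply: ico_ev_gen => i iF; have i3 : i < 3.
    have /allP/(_ _ iF) // : all (gtn 3) (vertex_word (vnum F)).
    have /allP/(_ (vnum F)) : all (fun x => all (gtn 3) (vertex_word x)) (iota 0 12) by [].
    by rewrite mem_iota vnum_lt => /(_ isT).
  by split=> //=; rewrite inordK.
by move=> j jF; apply/power_supp_lift; right; exists F.
Qed.

Lemma power_C_group : C_group rho.
Proof. exact: supp_C_group rho2 power_supp1 power_suppM power_gen_supp rho_neq1. Qed.

Lemma rho_string (i j : 'I_4) :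
  (i.+1 < j) || (j.+1 < i) -> (rho i * rho j) ^+ 2 = 1.
Proof.
wlog ij : i j / i.+1 < j => [wl|_].
  move=> /[dup] /orP[ij|ji] ij'; first exact: wl.
  have -> : rho i * rho j = (rho j * rho i)^-1.
    by rewrite invgM (mulg1_eq (rho2 i)) (mulg1_eq (rho2 j)).
  by rewrite expVgn wl ?ji ?orbT ?invg1.
case: (unliftP ord0 j) ij => [l ->|-> //]; rewrite rho_liftE /= /bump add1n ltnS.
case: (unliftP ord0 i) => [k ->|->].
  rewrite rho_liftE -sd_leftM -(morphismX (sd_leftM act)) /= /bump add1n => kl.
  have := ico_tau_order (ltn_ord k) (ltn_ord l); rewrite !inord_val.
  rewrite (gtn_eqF kl) (ltn_eqF (ltn_trans (ltn_trans (ltnSn k) kl) (ltnSn l))).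
  by move=> ->; apply: morphism1 (sd_leftM act).
rewrite rho0E => l_gt0.
have lS : sigma base ^+ 1 = sigma (face_shift base (ico_tau l)).
  rewrite expg1 face_shift_stab //; apply: mem_genP; exists l => // l0.
  by rewrite l0 in l_gt0.
have cl : commute (inr (sigma base)) (inl (ico_tau l)).
  by rewrite /commute conjgC sigma_conj -lS expg1.
by rewrite (expgMn _ cl) !expg2 -sd_rightM sigma2 -sd_leftM ico_tau2 (morphism1 (sd_leftM act)) (morphism1 (sd_rightM act)) mulg1.
Qed.

Lemma vertex_gen_commute F F' : F' <> face_shift F ico_alpha ->
  (sigma F * sigma F') ^+ 2 = 1.
Proof.
move=> /eqP FF'; have := cox_gen_order (antipodal_diagram ico_alpha s) F F'.
by rewrite [antipodal_diagram _ _ _ _]/antipodal_diagram ifN.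
Qed.

Lemma vertex_gen_antipode F : (sigma F * sigma (face_shift F ico_alpha)) ^+ s = 1.
Proof.
have := cox_gen_order (antipodal_diagram ico_alpha s) F (face_shift F ico_alpha).
by rewrite [antipodal_diagram _ _ _ _]/antipodal_diagram eqxx.
Qed.

(** With [a = rho_0] and [t = rho_1], the square of [a * t] is the product of
  the commuting generators of two adjacent vertices. *)
Lemma rho01_order : has_order (inr (sigma base) * inl (ico_tau ord0)) 4.
Proof.
set a := inr _; set t := inl _; pose F' := face_shift base (ico_tau ord0).
have sq : (a * t) ^+ 2 = inr (sigma base * sigma F').
  have tV : t = t^-1 by apply/esym/mulg1_eq; rewrite -sd_leftM ico_tau2.
  by rewrite sd_rightM -sigma_conj -/a -/t conjgE -tV expg2 !mulgA.
have F'0 : vnum F' = 1%N by rewrite vnum_tau vnum_base.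
have p4 : (a * t) ^+ 4 = 1.
  rewrite (expgnA _ 2 2) sq -(morphismX (sd_rightM act)) vertex_gen_commute.
    exact: morphism1 (sd_rightM act).
  by move=> /(congr1 vnum); rewrite F'0 vnum_alpha vnum_base.
have n1 : a * t <> 1.
  rewrite /a /t sd_mul_left => /(congr1 fst) /=; rewrite mul1g.
  exact: ico_tau_neq1.
split=> // -[|[|[|[|k]]]] // _; rewrite ?expg1 // ?sq.
  move=> /(congr1 snd) /= /mulg1_eq; rewrite (mulg1_eq (sigma2 _ _)).
  by move=> /vertex_gen_inj/(congr1 vnum); rewrite vnum_base F'0.
by move=> p3; apply: n1; rewrite -p4 expgSr p3 mul1g.
Qed.

Lemma has_order_inj (G H : groupType) (f : G -> H) x n :
  {morph f : y z / y * z} -> injective f -> has_order x n -> has_order (f x) n.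
Proof.
move=> fM f_inj [n_gt0 xn xk]; split=> // [|k /xk xk1].
  by rewrite -(morphismX fM) xn (morphism1 fM).
by rewrite -(morphismX fM) -(morphism1 fM) => /f_inj.
Qed.

Lemma rho_inord k : k < 3 -> rho (inord k.+1) = inl (ico_tau (inord k)).
Proof.
move=> k3; rewrite -rho_liftE; congr rho; apply: val_inj.
by rewrite /= !inordK.
Qed.

Lemma rho_schlafli : schlafli_type (p := [:: 4; 3; 5]%N) rho.
Proof.
have inl_inj : injective inl by move=> g h [].
have inordS : inord 0 = ord0 :> 'I_4 by apply: val_inj; rewrite /= inordK.
have tau12 u v : ico_tau (inord u) * ico_tau (inord v) = ico_ev [:: u; v].
  by rewrite ico_ev_cons /ico_ev big_seq1.
case=> [[|[|[|//]]] ?] /=.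
- rewrite inordS rho0E rho_inord // (_ : inord 0 = ord0); first exact: rho01_order.
  by apply: val_inj; rewrite /= inordK.
- rewrite !rho_inord // -sd_leftM; apply: has_order_inj => //; first exact: sd_leftM.
  rewrite tau12; apply: (@ico_order _ 0) => //.
  by rewrite -tau12 (ico_tau_order (i := 0) (j := 1)).
rewrite !rho_inord // -sd_leftM; apply: has_order_inj => //; first exact: sd_leftM.
rewrite tau12; apply: (@ico_order _ 1) => //.
by rewrite -tau12 (ico_tau_order (i := 1) (j := 2)).
Qed.

End PowerGroup.

(** * The action transported to the dihedral factors *)

Lemma waction_transport (W W' G : groupType) (A : waction W G) (phi : W -> W') :
    group_iso phi ->
  exists (A' : waction W' G) (f : semidirect A -> semidirect A'),
    [/\ group_iso f, forall g, f (sd_left A g) = sd_left A' g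
      & forall w, f (sd_right A w) = sd_right A' (phi w)].
Proof.
move=> [phiM [psi psiK phiK]].
have psiM : {morph psi : v w / v * w}.
  by move=> v w; apply: (can_inj psiK); rewrite phiM !phiK.
pose a v g := phi (A (psi v) g).
have a1 v : a v 1 = v by rewrite /a wact1 phiK.
have aM v g h : a v (g * h) = a (a v g) h by rewrite /a wactM psiK.
have a_morph g : {morph a^~ g : v w / v * w}.
  by move=> v w; rewrite /a psiM wact_morph phiM.
exists (WAction a1 aM a_morph), (fun x => (x.1, phi x.2)); split=> //.
- split; last by exists (fun x => (x.1, psi x.2)) => -[g w] /=; rewrite ?psiK ?phiK.
  by case=> g w [h v]; congr (_, _); rewrite /= phiM /a psiK.
- by move=> g; congr (_, _); apply: morphism1.
Qed.

Lemma power_group_card s : 2 <= s ->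
  ([set: power_group ico_central_symmetry s] #= `I_(120 * (2 * s) ^ 6)%N)%card.
Proof.
move=> s2; have [x [y [xx yy xys xyT]]] := dihedral_involutions s2.
have [_ phi_bij] := vertex_isoP s2 xx yy xys xyT.
have [e [e' eK e'K]] := ico_card.
case: phi_bij => psi phiK psiK.
pose T : finType := ('I_120 * {ffun 'I_6 -> 'D_(2 * s)%N})%type.
have cT : #|T| = (120 * (2 * s) ^ 6)%N.
  rewrite card_prod card_ord card_ffun card_ord.
  by rewrite -[in RHS](card_dihedral2 s2) cardsT.
pose f (u : power_group ico_central_symmetry s) : 'I_#|T| :=
  enum_rank ((e' u.1, vertex_iso x y u.2) : T).
have f_inj : injective f.
  move=> [g w] [h v] /enum_rank_inj[/(can_inj e'K) -> wv].
  by rewrite (can_inj phiK wv).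
have f_surj : f @` setT = setT.
  apply/seteqP; split=> // i _; exists (e (enum_val i).1, psi (enum_val i).2) => //.
  by rewrite /f /= eK psiK -surjective_pairing enum_valK.
rewrite -cT; apply: card_eq_trans (card_esym card_II).
rewrite -f_surj; apply: card_esym; apply: inj_card_eq.
by move=> u v _ _; apply: f_inj.
Qed.

(** * The presentation *)

(** A string C-group satisfies the relations of the Coxeter group of its type. *)
Lemma schlafli_coxeter (G : groupType) (p : seq nat) (rho : 'I_(size p).+1 -> G) :
    (forall i, rho i * rho i = 1) -> string_C_group rho -> schlafli_type rho ->
  forall i j, (rho i * rho j) ^+ @linear_diagram p i j = 1.
Proof.
move=> rho_2 [_ strg] schl.
have adj (i j : 'I_(size p).+1) : j = i.+1 :> nat -> (rho i * rho j) ^+ nth 0%N p i = 1.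
  move=> ji; have ip : i < size p by rewrite -ltnS -ji.
  have [_ + _] := schl (Ordinal ip); rewrite /= -ji.
  by rewrite !inord_val.
move=> i j; rewrite /linear_diagram; case: eqP => [/adj //|ji].
case: eqP => [/adj ij|ij].
  have -> : rho i * rho j = (rho j * rho i)^-1.
    by rewrite invgM (mulg1_eq (rho_2 i)) (mulg1_eq (rho_2 j)).
  by rewrite expVgn ij invg1.
have [->|nij] := eqVneq i j; first by rewrite rho_2 expg1n.
apply: strg; move: nij; rewrite -val_eqE neq_ltn /= !ltn_neqAle.
by rewrite ![_.+1 == _]eq_sym; case/orP=> ->; rewrite andbT; apply/orP; [left|right]; apply/eqP.
Qed.

Lemma linear_diagram_lift n p (i j : 'I_(size p).+1) :
  @linear_diagram (n :: p) (lift ord0 i) (lift ord0 j) = @linear_diagram p i j.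
Proof. by rewrite /linear_diagram /= /bump !add1n !eqSS. Qed.

Lemma normal_closureP (G : groupType) (A : set G) : normal_subgroup (normal_closure A).
Proof.
split; first split=> [S [[[]]]//|x y Ax Ay S SP|x Ax S SP].
- by have [[[_ SM _] _] _] := SP; apply: SM; [apply: Ax | apply: Ay].
- by have [[[_ _ SV] _] _] := SP; apply: SV; apply: Ax.
- by move=> x y Ax S SP; have [[_ SJ] _] := SP; apply: SJ; apply: Ax.
Qed.

Section Presentation.
Variable s : nat.
Hypothesis s2 : 2 <= s.

Local Notation sym := ico_central_symmetry.
Local Notation V := (vertex ico_tau).
Local Notation W := (vertex_coxeter ico_tau ico_alpha s).
Local Notation act := (vertex_action sym s).
Local Notation P := (power_group sym s).
Local Notation rho := (@power_gen _ _ ico_tau ico_alpha sym s).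
Local Notation sigma := (@vertex_gen _ _ ico_tau ico_alpha s).
Local Notation base := (base_vertex ico_tau).
Local Notation inl := (sd_left act).
Local Notation inr := (sd_right act).
Local Notation cox435 := (linear_coxeter [:: 4; 3; 5]%N).

Lemma power_string_C_group : string_C_group rho.
Proof. by split; [apply: power_C_group | apply: rho_string]. Qed.

Definition power_map : cox435 -> P := @cox_lift _ (@linear_diagram [:: 4; 3; 5]%N) _ rho.

Fact rho_relations i j : (rho i * rho j) ^+ @linear_diagram [:: 4; 3; 5]%N i j = 1.
Proof.
exact: (@schlafli_coxeter P [:: 4; 3; 5]%N rho (@rho2 s) power_string_C_group (rho_schlafli s2)).
Qed.

Lemma power_map_gen i : power_map (linear_gen i) = rho i.
Proof. exact: cox_lift_gen (@rho2 s) rho_relations i. Qed.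

Lemma power_mapM : {morph power_map : x y / x * y}.
Proof. exact: cox_liftM (@rho2 s) rho_relations. Qed.

Lemma power_map_surj y : exists x, power_map x = y.
Proof.
have [rhoT _ _] := power_C_group s2.
have sub : subgroup (range power_map).
  split=> [|_ _ [x _ <-] [x' _ <-]|_ [x _ <-]].
  - by exists 1 => //; apply: morphism1 power_mapM.
  - by exists (x * x') => //; apply: power_mapM.
  - by exists x^-1 => //; apply: morphismV power_mapM _.
have [] // : range power_map y; last by move=> x _ <-; exists x.
suff : gen_subgroup (range rho) `<=` range power_map by apply; rewrite rhoT.
apply: (gen_subgroup_min sub) => _ [i _ <-]; exists (linear_gen (i : 'I_(size [:: 4; 3; 5]%N).+1)) => //.
exact: power_map_gen.
Qed.

Definition gen435 (k : nat) : cox435 := linear_gen (inord k : 'I_(size [:: 4; 3; 5]%N).+1).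
Definition beta435 : cox435 := gen435 1%N * gen435 2%N * gen435 3%N.

Definition power_relators : set cox435 :=
  [set (gen435 0%N * beta435 ^- 3 * gen435 0%N * beta435 ^+ 3) ^+ 2;
       (gen435 0%N * beta435 ^+ 5 * gen435 0%N * beta435 ^+ 5) ^+ s].

Lemma ico_beta_alpha : ico_beta ^+ 5 = ico_alpha.
Proof. by rewrite ico_beta_exp ico_alphaE. Qed.

Lemma ico_betaE : ico_beta = ico_tau (inord 0) * ico_tau (inord 1) * ico_tau (inord 2).
Proof. by rewrite /ico_beta !ico_ev_cons /ico_ev big_nil mulg1 mulgA. Qed.

Lemma ico_alpha2 : ico_alpha * ico_alpha = 1.
Proof. by have [_ a2 _] := cs_order sym; rewrite -expg2. Qed.

Lemma inord0 n : inord 0 = ord0 :> 'I_n.+1.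
Proof. by apply: val_inj; rewrite /= inordK. Qed.

Lemma power_map_beta : power_map beta435 = inl ico_beta.
Proof.
rewrite /beta435 !power_mapM !power_map_gen !rho_inord // ico_betaE.
by rewrite !(sd_leftM act).
Qed.

Lemma vnum_beta3 : vnum (face_shift base (ico_beta ^+ 3)) = 9%N.
Proof. by rewrite ico_beta_exp vnum_ev vnum_base. Qed.

Lemma power_relators_ker : power_relators `<=` [set x | power_map x = 1].
Proof.
have ruleE g : inr (sigma base) * (inl g)^-1 * inr (sigma base) * inl g =
    inr (sigma base * sigma (face_shift base g)).
  by rewrite sd_rightM -sigma_conj conjgE !mulgA.
have r0E : power_map (gen435 0) = inr (sigma base).
  by rewrite power_map_gen inord0 rho0E.
have mapX := morphismX power_mapM.
have mapE b c : power_map (gen435 0 * b * gen435 0 * c) =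
    inr (sigma base) * power_map b * inr (sigma base) * power_map c.
  by rewrite !power_mapM r0E.
move=> _ [->|->] /=; rewrite mapX mapE.
  rewrite (morphismV power_mapM) !mapX power_map_beta -(morphismX (sd_leftM act)).
  rewrite ruleE -(morphismX (sd_rightM act)) vertex_gen_commute.
    exact: morphism1 (sd_rightM act).
  by move=> /(congr1 vnum); rewrite vnum_beta3 vnum_alpha vnum_base.
rewrite !mapX power_map_beta -(morphismX (sd_leftM act)) ico_beta_alpha.
have aV : inl ico_alpha = (inl ico_alpha)^-1.
  by apply/esym/mulg1_eq; rewrite -sd_leftM ico_alpha2 (morphism1 (sd_leftM act)).
rewrite [X in _ * X * _ * _]aV ruleE -(morphismX (sd_rightM act)).
by rewrite vertex_gen_antipode; apply: morphism1 (sd_rightM act).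
Qed.

Local Notation K := (normal_closure power_relators).

Definition power_quotient : groupType := factor_group (normal_closureP power_relators).
Definition quo435 : cox435 -> power_quotient := quo (normal_closureP power_relators).

Lemma quo435M : {morph quo435 : x y / x * y}. Proof. exact: quoM. Qed.

Lemma q_relator x : power_relators x -> quo435 x = 1.
Proof. by move=> Kx; apply/quo_eq1; apply: sub_gen_smallest. Qed.

Definition q_tau (j : 'I_3) : power_quotient :=
  quo435 (linear_gen (lift ord0 j : 'I_(size [:: 4; 3; 5]%N).+1)).
Definition q0 : power_quotient := quo435 (linear_gen (ord0 : 'I_(size [:: 4; 3; 5]%N).+1)).

Lemma q_gen_order (i j : 'I_(size [:: 4; 3; 5]%N).+1) :
  (quo435 (linear_gen i) * quo435 (linear_gen j)) ^+ @linear_diagram [:: 4; 3; 5]%N i j = 1.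
Proof. by rewrite -quo435M -(morphismX quo435M) cox_gen_order (morphism1 quo435M). Qed.

Lemma q_gen2 (i : 'I_(size [:: 4; 3; 5]%N).+1) : quo435 (linear_gen i) * quo435 (linear_gen i) = 1.
Proof. by rewrite -quo435M cox_gen2 (morphism1 quo435M). Qed.

Definition q_ico : ico_group -> power_quotient :=
  @cox_lift _ (@linear_diagram [:: 3; 5]%N) _ q_tau.

Fact q_tau2 j : q_tau j * q_tau j = 1. Proof. exact: q_gen2. Qed.

Fact q_tau_order i j : (q_tau i * q_tau j) ^+ @linear_diagram [:: 3; 5]%N i j = 1.
Proof. by rewrite -(@linear_diagram_lift 4); apply: q_gen_order. Qed.

Lemma q_icoM : {morph q_ico : x y / x * y}.
Proof. exact: cox_liftM q_tau2 q_tau_order. Qed.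

Lemma q_ico_tau j : q_ico (ico_tau j) = q_tau j.
Proof. exact: cox_lift_gen q_tau2 q_tau_order j. Qed.

(** The stabilizer of the base vertex is generated by the last two generators of
  [3,5], and these commute with the first generator of [4,3,5]. *)
Lemma q_ico_stab t : face_stabilizer ico_tau ord0 t -> q0 ^ q_ico t = q0.
Proof.
pose S := [set t | q0 ^ q_ico t = q0].
suff : gen_subgroup (ico_tau @` [set~ ord0]) `<=` S by apply.
apply: gen_subgroup_min => [|_ [j /= /eqP j0 <-]].
  split=> [|x y /= Sx Sy|x /= Sx]; rewrite /S /=.
  - by rewrite (morphism1 q_icoM) conjg1.
  - by rewrite q_icoM conjgM Sx.
  - by rewrite (morphismV q_icoM) -{1}Sx conjgK.
rewrite /S /= q_ico_tau conjgE (commute_involutions (x := q0) (q_gen2 _) (q_tau2 j)).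
  by rewrite mulKg.
suff {1}<- : @linear_diagram [:: 4; 3; 5]%N ord0 (lift ord0 j) = 2 by apply: q_gen_order.
by rewrite /linear_diagram /=; case: j j0 => [[]].
Qed.

(** The conjugates of the first generator, indexed by the vertices. *)
Definition q_vertex (F : V) : power_quotient := q0 ^ q_ico (ico_ev (vertex_word (vnum F))).

(** The choice of [g] does not matter, by [q_ico_stab]. *)
Lemma q_vertex_base g : q_vertex (face_shift base g) = q0 ^ q_ico g.
Proof.
rewrite /q_vertex; set h := ico_ev _.
have : face_shift base h = face_shift base g by apply: vnumK.
move/face_shift_base/q_ico_stab; rewrite q_icoM (morphismV q_icoM) conjgM => e.
by rewrite -[in RHS]e conjgKV.
Qed.

Lemma q_vertex0 : q_vertex base = q0.
Proof.
by rewrite -(face_shift1 base) q_vertex_base (morphism1 q_icoM) conjg1.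
Qed.

Lemma q_vertex_shift F g : q_vertex (face_shift F g) = q_vertex F ^ q_ico g.
Proof.
have [h ->] := face_baseP F.
by rewrite -face_shiftM !q_vertex_base q_icoM conjgM.
Qed.

Lemma q_vertex2 F : q_vertex F * q_vertex F = 1.
Proof. by rewrite /q_vertex -conjMg q_gen2 conj1g. Qed.

Lemma q_ico_beta : q_ico ico_beta = quo435 beta435.
Proof.
rewrite ico_betaE !q_icoM !q_ico_tau /beta435 !quo435M /q_tau.
by congr (quo435 (linear_gen _) * quo435 (linear_gen _) * quo435 (linear_gen _));
  apply: val_inj; rewrite /= !inordK.
Qed.

Lemma quo435_gen0 : quo435 (gen435 0) = q0. Proof. by rewrite /gen435 inord0. Qed.

Lemma q_rel b c : quo435 (gen435 0 * b * gen435 0 * c) = q0 * quo435 b * q0 * quo435 c.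
Proof. by rewrite !quo435M quo435_gen0. Qed.

(** The relations of W between the base vertex and one vertex of each orbit. In
  the case of the antipode, [alpha] is an involution, so that [beta^5] may
  replace its inverse. *)
Fact q_vertex_order_base m :
    [\/ m = 1, m = ico_alpha, m = ico_tau (inord 0) | m = ico_beta ^+ 3] ->
  (q0 * q0 ^ q_ico m) ^+ antipodal_diagram ico_alpha s base (face_shift base m) = 1.
Proof.
have diag2 F n : vnum F = n -> n != 11 -> antipodal_diagram ico_alpha s base F = 2.
  move=> Fn n11; rewrite /antipodal_diagram ifN //.
  by apply: contraNneq n11 => Fa; rewrite -Fn Fa vnum_alpha vnum_base.
case=> ->.
- by rewrite (morphism1 q_icoM) conjg1 q_gen2 expg1n.
- have -> : antipodal_diagram ico_alpha s base (face_shift base ico_alpha) = s.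
    by rewrite /antipodal_diagram eqxx.
  have /q_relator : power_relators ((gen435 0%N * beta435 ^+ 5 * gen435 0%N * beta435 ^+ 5) ^+ s) by right.
  rewrite (morphismX quo435M) q_rel !(morphismX quo435M) -q_ico_beta -(morphismX q_icoM) ico_beta_alpha.
  have aV : q_ico ico_alpha = (q_ico ico_alpha)^-1.
    by apply/esym/mulg1_eq; rewrite -q_icoM ico_alpha2 (morphism1 q_icoM).
  by rewrite [X in _ * X * _ * _]aV conjgE !mulgA.
- rewrite (@diag2 _ 1%N) //; last by rewrite vnum_tau vnum_base inord0.
  have := q_gen_order ord0 (lift ord0 ord0).
  have -> : @linear_diagram [:: 4; 3; 5]%N ord0 (lift ord0 ord0) = (2 * 2)%N by [].
  rewrite expgnA => e; rewrite -[RHS]e; congr (_ ^+ 2).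
  rewrite inord0 q_ico_tau expg2 conjgE (mulg1_eq (q_tau2 _)) !mulgA.
  by [].
rewrite (@diag2 _ 9%N) //; last exact: vnum_beta3.
have /q_relator : power_relators ((gen435 0%N * beta435 ^- 3 * gen435 0%N * beta435 ^+ 3) ^+ 2) by left.
rewrite (morphismX quo435M) q_rel (morphismV quo435M) !(morphismX quo435M) -q_ico_beta -(morphismX q_icoM).
by rewrite conjgE !mulgA.
Qed.

(** Conjugation moves the first vertex to the base vertex; conjugation by the
  stabilizer of the base vertex then moves the second one to the chosen
  representative of its orbit. *)
Fact q_vertex_order F F' :
  (q_vertex F * q_vertex F') ^+ antipodal_diagram ico_alpha s F F' = 1.
Proof.
have [g ->] := face_baseP F.
have {F'} [F' ->] : exists E, F' = face_shift E g.
  by exists (face_shift F' g^-1); rewrite -face_shiftM mulVg face_shift1.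
rewrite (antipodal_diagram_shift sym) !q_vertex_shift -conjMg -conjXg.
suff -> : (q_vertex base * q_vertex F') ^+ antipodal_diagram ico_alpha s base F' = 1.
  exact: conj1g.
have [m [t [-> t_stab mP]]] := vertex_orbits F'.
have base_t : base = face_shift base t by rewrite face_shift_stab.
rewrite face_shiftM {1 3}base_t (antipodal_diagram_shift sym) !q_vertex_shift -conjMg -conjXg.
by rewrite q_vertex0 q_vertex_order_base ?conj1g.
Qed.

Definition q_W : W -> power_quotient :=
  @cox_lift _ (antipodal_diagram ico_alpha s) _ q_vertex.

Lemma q_WM : {morph q_W : v w / v * w}.
Proof. exact: cox_liftM q_vertex2 q_vertex_order. Qed.

Lemma q_W_sigma F : q_W (sigma F) = q_vertex F.
Proof. exact: cox_lift_gen q_vertex2 q_vertex_order F. Qed.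

Lemma q_W_act w g : q_W (act w g) = q_W w ^ q_ico g.
Proof.
move: w; apply: cox_morphism_eq => [v w|v w|F].
- by rewrite (wact_morph act) q_WM.
- by rewrite q_WM conjMg.
- have := q_W_sigma (face_shift F g); rewrite -(vertex_action_gen sym) => ->.
  by rewrite q_vertex_shift; congr (_ ^ _); rewrite -q_W_sigma.
Qed.

(** The morphism back from the polytope group, after the projection of [4,3,5]
  onto that group, is the quotient map: the two agree on generators. *)
Lemma power_map_section x : sd_lift q_ico q_W (power_map x) = quo435 x.
Proof.
have liftM := sd_liftM q_icoM q_WM q_W_act.
move: x; apply: cox_morphism_eq => [x y|x y|i].
- by rewrite power_mapM liftM.
- exact: quo435M.
rewrite [power_map _]power_map_gen; case: (unliftP ord0 i) => [j ->|->].
  by rewrite rho_liftE /sd_lift /= (morphism1 q_WM) mulg1 q_ico_tau.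
rewrite rho0E /sd_lift /= (morphism1 q_icoM) mul1g q_W_sigma.
exact: q_vertex0.
Qed.

Lemma power_map_quotient : quotient_by power_relators power_map.
Proof.
split; [exact: power_mapM | exact: power_map_surj | apply/seteqP; split].
  move=> x /= x1; apply/(quo_eq1 (normal_closureP power_relators)).
  rewrite -/(quo435 x) -power_map_section x1 /sd_lift /=.
  by rewrite (morphism1 q_icoM) (morphism1 q_WM) mulg1.
apply: smallest_sub; first exact: (ker_normal_subgroup power_mapM).
exact: power_relators_ker.
Qed.

End Presentation.

Theorem corollary4p1 (s : nat) (hs : 2 <= s) :
  let G := power_group ico_central_symmetry s in
  let rho : 'I_4 -> G := power_gen ico_central_symmetry s in
  [/\ string_C_group rho,
      schlafli_type (p := [:: 4; 3; 5]%N) rho,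
      (exists (A : waction (dihedral_power s 6) ico_group)
              (phi : vertex_coxeter ico_tau ico_alpha s -> dihedral_power s 6)
              (f : G -> semidirect A),
         [/\ group_iso phi, group_iso f,
             forall g, f (sd_left _ g) = sd_left A g
           & forall w, f (sd_right _ w) = sd_right A (phi w)]),
      ([set: G] #= `I_(120 * (2 * s) ^ 6)%N)%card
    & exists pi : linear_coxeter [:: 4; 3; 5]%N -> G,
        let r k := linear_gen (inord k : 'I_(size [:: 4; 3; 5]%N).+1) in
        let beta := r 1%N * r 2%N * r 3%N in
        [/\ forall i, pi (linear_gen i) = rho i
          & quotient_by
              [set (r 0%N * beta ^- 3 * r 0%N * beta ^+ 3) ^+ 2;
                   (r 0%N * beta ^+ 5 * r 0%N * beta ^+ 5) ^+ s]
              pi]].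
Proof.
move=> G rho; split.
- exact: power_string_C_group.
- exact: rho_schlafli.
- have [x [y [xx yy xys xyT]]] := dihedral_involutions hs.
  have phiP := vertex_isoP hs xx yy xys xyT.
  have [A [f [fP fl fr]]] := waction_transport (vertex_action ico_central_symmetry s) phiP.
  by exists A, (vertex_iso x y), f.
- exact: power_group_card.
exists (@power_map s); split; first exact: power_map_gen.
exact: power_map_quotient.
Qed.
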